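(* For each $n\in\mathbb{N}$, let $d_n\in\mathbb{N}$, let $\kappa_n\in(0,1)$, and let $\{E_{t,n}\}_{t\in\mathbb{Z}}$ be an i.i.d. sequence (in $t$) of non-degenerate Gaussian random vectors $E_{t,n}=(E_{t,1,n},\ldots,E_{t,d_n,n})^\top$ in $\mathbb{R}^{d_n}$. Let $\{X_{t,n}\}_{t\in\mathbb{Z}}$ be the $d_n$-dimensional stationary Gaussian process $$X_{t,n}=\sum_{j=0}^{\infty}\kappa_n^{j}E_{t-j,n},\qquad t\in\mathbb{Z},$$ so that $X_{t,n}=\kappa_n X_{t-1,n}+E_{t,n}$ for all $t\in\mathbb{Z}$. Assume further that, for each $n$, the components $E_{0,1,n},\ldots,E_{0,d_n,n}$ of $E_{0,n}$ are i.i.d. Then for any positive integers $n$ and $m$, $$\beta(\{X_{t,n}\}_{t\in\mathbb{Z}};m)\;\geq\;1-2\exp\Big(-\frac{d_n\kappa_n^{2m}}{18\pi^2}\Big).$$ In particular, if either (1) $d_n=d$ does not change with $n$ and $\lim_{n\to\infty}\kappa_n^{2n}>\frac{18\pi^2\log 2}{d}$, or (2) $\kappa_n=\kappa$ does not change with $n$ and $\lim_{n\to\infty}d_n\kappa^{2n}>18\pi^2\log 2$, then $\liminf_{n\to\infty}\beta(\{X_{t,n}\}_{t\in\mathbb{Z}};n)>0$.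
   Context: Let $(\Omega,\mathcal{F},\mathbb{P})$ be the underlying probability space. For two $\sigma$-fields $\mathcal{A},\mathcal{B}\subset\mathcal{F}$ define $$\beta(\mathcal{A},\mathcal{B}):=\sup\frac12\sum_{i=1}^{I}\sum_{j=1}^{J}\big|\mathbb{P}(A_i\cap B_j)-\mathbb{P}(A_i)\mathbb{P}(B_j)\big|,$$ where the supremum is taken over all pairs of finite partitions $\{A_1,\ldots,A_I\}$ and $\{B_1,\ldots,B_J\}$ of $\Omega$ with $A_i\in\mathcal{A}$ and $B_j\in\mathcal{B}$ for all $i,j$. For a time series $\{X_t\}_{t\in\mathbb{Z}}$ of random vectors and a positive integer $m$, the $\beta$-mixing coefficient is $$\beta(\{X_t\}_{t\in\mathbb{Z}};m):=\sup_{j\in\mathbb{Z}}\beta\big(\sigma(\{X_t\}_{t\leq j}),\sigma(\{X_t\}_{t\geq j+m})\big),$$ where $\sigma(\cdot)$ denotes the generated $\sigma$-field. In the model above, both the dimension $d_n$ and all other parameters (including $\kappa_n$ and the distribution of $E_{0,n}$) are allowed to depend on $n$ (triangular array setting). No relation is assumed between the processes for different $n$. $\log$ is the natural logarithm. *)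

(* Defs.v *)
From HB Require Import structures.
From mathcomp Require Import all_boot all_order all_algebra.
From mathcomp Require Import all_classical all_reals all_analysis.

Set Implicit Arguments.
Unset Strict Implicit.
Unset Printing Implicit Defensive.
Import Order.TTheory GRing.Theory Num.Theory.
Import numFieldNormedType.Exports.

Local Open Scope classical_set_scope.
Local Open Scope ring_scope.

(* Sigma-fields on [T] are represented as set systems [set (set T)], random
   vectors in R^k as functions with values in [k.-tuple R] equipped with the
   product sigma-algebra. *)

Section mixing.
Context {disp : measure_display} {T : measurableType disp} {R : realType}.
Variable P : probability T R.
Local Open Scope ereal_scope.

Definition beta_coef (A B : set (set T)) : \bar R :=
  ereal_sup [set b | exists (I J : nat) (F : 'I_I -> set T) (G : 'I_J -> set T),
    [/\ partition [set: 'I_I] F [set: T] /\ (forall i, A (F i)),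
        partition [set: 'I_J] G [set: T] /\ (forall j, B (G j)) &
        b = (2^-1)%:E *
            \sum_(i < I) \sum_(j < J) `|P (F i `&` G j) - P (F i) * P (G j)|]].

Definition sigma_gen {disp' : measure_display} {U : measurableType disp'}
    (X : int -> T -> U) (S : set int) : set (set T) :=
  <<s \bigcup_(t in S) preimage_set_system [set: T] (X t) measurable >>.

Definition beta_mixing {disp' : measure_display} {U : measurableType disp'}
    (X : int -> T -> U) (m : nat) : \bar R :=
  ereal_sup [set beta_coef (sigma_gen X [set t | (t <= j)%R])
                           (sigma_gen X [set t | (j + m%:Z <= t)%R])
            | j in [set: int]].

End mixing.

Section iid.
Context {disp disp' : measure_display} {T : measurableType disp}
  {U : measurableType disp'} {R : realType} {I : eqType}.
Variables (P : probability T R) (X : I -> T -> U).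
Local Open Scope ereal_scope.

Definition independent : Prop :=
  forall (s : seq I) (B : I -> set U), uniq s -> (forall i, measurable (B i)) ->
    P (\bigcap_(i in [set` s]) X i @^-1` B i) = \prod_(i <- s) P (X i @^-1` B i).

Definition identically_distributed : Prop :=
  forall (i j : I) (B : set U), measurable B ->
    P (X i @^-1` B) = P (X j @^-1` B).

Definition iid : Prop := independent /\ identically_distributed.

End iid.

Section gaussian.
Context {disp : measure_display} {T : measurableType disp} {R : realType}.
Variables (P : probability T R).

(* [normal_prob m s] is the law N(m, s^2) only for [s != 0] (for [s = 0] the
   library returns the uniform law on [0, 1]), hence the separate Dirac case. *)
Definition gaussian_rv (Y : T -> R) : Prop :=
  exists m s : R, forall B : set (measurableTypeR R), measurable B ->
    P (Y @^-1` B) = if s == 0 then \d_m B else normal_prob m s B.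

Definition gaussian_vector (k : nat) (Y : T -> k.-tuple R) : Prop :=
  forall a : 'I_k -> R, gaussian_rv (fun w => \sum_(i < k) a i * tnth (Y w) i).

Definition covariance_mx (k : nat) (Y : T -> k.-tuple R) : 'M[R]_k :=
  \matrix_(i, j) fine (covariance P (fun w => tnth (Y w) i)
                                    (fun w => tnth (Y w) j)).

Definition nondegenerate_gaussian (k : nat) (Y : T -> k.-tuple R) : Prop :=
  gaussian_vector Y /\ covariance_mx Y \in unitmx.

End gaussian.

(* Main.v *)
(** The statistic is the sign pattern of the centred coordinates of [X_j] and
    [X_(j+m)].  In each coordinate, [X_(j+m) = kappa^m X_j + W] with [W] an
    independent centred normal variable, and the two signs agree with
    probability at least [1/2 + kappa^m / 4]: conditionally on [X_j] the excess
    is half of [P(|W| < kappa^m |X_j|)], which unimodality of the normal law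
    compares with [P(|Z| < |Z'|) = 1/2] for [Z], [Z'] i.i.d. normal.  The
    coordinates being independent, the Hellinger affinity between the joint law
    of the two sign patterns and the product of its marginals is at most
    [exp(- d kappa^(2m) / 32)], and one minus the affinity bounds the total
    variation distance from below.  This gives a constant better than
    [18 pi^2].

    The infinite past is handled by truncation: for the partial sums every
    event above is determined by finitely many independent normal vectors, and
    the sign patterns converge almost surely because the limits do not charge
    [0]. *)

Require Import Defs.
From HB Require Import structures.
From mathcomp Require Import all_boot all_order all_algebra.
From mathcomp Require Import ring lra.
From mathcomp Require Import all_classical all_reals all_analysis.
From mathcomp Require Import measurable_realfun interval_inference.

Set Implicit Arguments.
Unset Strict Implicit.
Unset Printing Implicit Defensive.
Import Order.TTheory GRing.Theory Num.Theory.
Import numFieldNormedType.Exports.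

Local Open Scope classical_set_scope.
Local Open Scope ring_scope.

(** * Normal laws *)

Section image_measure.
Context {d1 d2 : measure_display} {T1 : measurableType d1}
  {T2 : measurableType d2} {R : realType}.

(** The canonical instance is named explicitly so that the pushforward is available as a bundled
    measure. *)
Definition image_measure (m : {measure set T1 -> \bar R}) (f : T1 -> T2)
    (mf : measurable_fun [set: T1] f) : {measure set T2 -> \bar R} :=
  measure_function_pushforward__canonical__measure_function_Measure m mf.

End image_measure.

Section normal_law.
Context {R : realType}.
Notation mu := (@lebesgue_measure R).
Implicit Types (m s c b x : R) (B : set (measurableTypeR R)).

Lemma measurable_affine c b :
  measurable_fun [set: measurableTypeR R]
    (fun x => c * x + b : measurableTypeR R).
Proof. by apply: measurable_funD => //; exact: mulrl_measurable. Qed.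

(** The right-hand side is a measure in [B], so uniqueness of Lebesgue measure reduces the claim to
    half-open intervals. For [c < 0] the preimage is closed on the other side, with the same
    length. *)
Lemma lebesgue_measure_affine c b B : c != 0 -> measurable B ->
  mu B = (`|c|%:E * mu ((fun x : R => c * x + b)%R @^-1` B))%E.
Proof.
move=> c0 mB.
pose f := fun x : measurableTypeR R => c * x + b : measurableTypeR R.
have mf : measurable_fun [set: measurableTypeR R] f by exact: measurable_affine.
pose k := NngNum (normr_ge0 c).
transitivity (mscale k (image_measure mu mf) B); last by [].
apply: lebesgue_measure_unique => // _ [[x y] _ <-] /=.
rewrite /mscale/= /pushforward.
have cE t : c * ((t - b) / c) + b = t by rewrite mulrC divfK// subrK.
have [cp|cn] := ltP 0 c.
- have -> : f @^-1` `]x, y] = `](x - b) / c, (y - b) / c]%classic.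
    apply/seteqP; split => z /=; rewrite /f !in_itv/= => /andP[].
      by rewrite ltr_pdivrMr// ler_pdivlMr// (mulrC z) ltrBlDr lerBrDr => -> ->.
    by rewrite ltr_pdivrMr// ler_pdivlMr// (mulrC z) ltrBlDr lerBrDr => -> ->.
  rewrite !lebesgue_measure_itv/= !lte_fin ltr_pM2r ?invr_gt0// ltrD2r.
  case: ifPn => _; last by rewrite mule0.
  by rewrite gtr0_norm// -!EFinB -EFinM; congr EFin; field.
- have {}cn : c < 0 by rewrite lt_neqAle c0.
  have -> : f @^-1` `]x, y] = `[(y - b) / c, (x - b) / c[%classic.
    apply/seteqP; split => z /=; rewrite /f !in_itv/= => /andP[].
      by rewrite ltr_ndivlMr// ler_ndivrMr// (mulrC z) ltrBlDr lerBrDr => -> ->.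
    by rewrite ltr_ndivlMr// ler_ndivrMr// (mulrC z) ltrBlDr lerBrDr => -> ->.
  rewrite !lebesgue_measure_itv/= !lte_fin ltr_nM2r ?invr_lt0// ltrD2r.
  case: ifPn => _; last by rewrite mule0.
  by rewrite ltr0_norm// -!EFinB -EFinM; congr EFin; field.
Qed.

Lemma normal_pdf_affine m s c b x : c != 0 -> s != 0 ->
  `|c| * normal_pdf (c * m + b) (c * s) (c * x + b) = normal_pdf m s x.
Proof.
move=> c0 s0; rewrite !normal_pdfE ?mulf_neq0// mulrA; congr (_ * _).
  rewrite /normal_peak exprMn -mulrA -mulrnAr sqrtrM ?sqr_ge0// sqrtr_sqr.
  by rewrite invfM mulrA divff ?mul1r ?normr_eq0.
rewrite /normal_fun; congr expR; rewrite opprD addrACA subrr addr0 -mulrBr.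
by field; rewrite c0 s0.
Qed.

(** Change of variables: Lebesgue measure equals [|c|] times its image under the affine map, and the
    density absorbs the factor [|c|]. A negative [c * s] is harmless because the density depends on
    its square. *)
Lemma normal_prob_affine m s c b B : c != 0 -> s != 0 -> measurable B ->
  normal_prob (c * m + b) (c * s) B
  = normal_prob m s ((fun x => c * x + b) @^-1` B).
Proof.
move=> c0 s0 mB.
pose f := fun x : measurableTypeR R => c * x + b : measurableTypeR R.
have mf : measurable_fun [set: measurableTypeR R] f by exact: measurable_affine.
pose k := NngNum (normr_ge0 c).
have mpdf m' s' D : measurable_fun D
    (fun x : measurableTypeR R => (normal_pdf m' s' x)%:E).
  by apply/measurable_EFinP/measurable_funTS; exact: measurable_normal_pdf.
rewrite /normal_prob.
transitivity (\int[mscale k (image_measure mu mf)]_(x in B)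
    (normal_pdf (c * m + b) (c * s) x)%:E)%E.
  apply: eq_measure_integral => A mA _.
  exact: (lebesgue_measure_affine b c0).
have pos x : (0 <= (normal_pdf (c * m + b) (c * s) x)%:E)%E.
  by rewrite lee_fin normal_pdf_ge0.
have mfB : measurable (f @^-1` B) by rewrite -[X in measurable X]setTI; exact: mf.
rewrite ge0_integral_mscale// ge0_integral_pushforward//.
rewrite -ge0_integralZl//=; last first.
  apply: (measurableT_comp (f := fun y => (normal_pdf (c * m + b) (c * s) y)%:E)).
    exact: mpdf.
  exact: measurable_funTS.
by apply: eq_integral => x _; rewrite -EFinM normal_pdf_affine.
Qed.

End normal_law.

(** * Sums of independent centred normal variables *)

Section normal_convolution.
Context {R : realType}.
Notation mu := (@lebesgue_measure R).
Implicit Types (m s c b x : R) (B : set (measurableTypeR R)).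

Lemma measurable_EFin_normal_pdf m s D :
  measurable_fun D (fun x : measurableTypeR R => (normal_pdf m s x)%:E).
Proof.
by apply/measurable_EFinP/measurable_funTS; exact: measurable_normal_pdf.
Qed.

(** The Radon-Nikodym derivative of the normal law agrees almost everywhere with the explicit
    density, since both have the same integral over every measurable set. *)
Lemma ge0_integral_normal_prob m s (f : measurableTypeR R -> \bar R) :
  measurable_fun setT f -> (forall x, 0 <= f x)%E ->
  (\int[normal_prob m s]_x f x = \int[mu]_x (f x * (normal_pdf m s x)%:E))%E.
Proof.
move=> mf f0; have dom := normal_prob_dominates m s.
rewrite -(Radon_Nikodym_SigmaFinite.change_of_variables dom)//.
have iRN := Radon_Nikodym_SigmaFinite.f_integrable dom.
apply: ae_eq_integral => //.
- by apply: emeasurable_funM => //; exact: measurable_int iRN.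
- by apply: emeasurable_funM => //; exact: measurable_EFin_normal_pdf.
- apply: ae_eqe_mul2l; apply: integral_ae_eq => //.
  + exact: measurable_EFin_normal_pdf.
  + by move=> E _ mE; rewrite -Radon_Nikodym_SigmaFinite.f_integral.
Qed.

Lemma normal_prob_shift x s B : s != 0 -> measurable B ->
  normal_prob x s B = normal_prob 0 s ((fun y => x + y) @^-1` B).
Proof.
move=> s0 mB; have := @normal_prob_affine R 0 s 1 x B (oner_neq0 _) s0 mB.
rewrite mulr0 add0r mul1r => ->; congr normal_prob.
by apply/seteqP; split => y /=; rewrite mul1r addrC.
Qed.

(* Completing the square in [x]; integrating [x] out of the right-hand side
   gives the convolution of the two normal laws. *)
Lemma normal_pdf_mul s t x z : s != 0 -> t != 0 ->
  let u := Num.sqrt (s ^+ 2 + t ^+ 2) in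
  normal_pdf x t z * normal_pdf 0 s x =
  normal_pdf 0 u z * normal_pdf (z * s ^+ 2 / u ^+ 2) (s * t / u) x.
Proof.
move=> s0 t0 u.
have u2 : u ^+ 2 = s ^+ 2 + t ^+ 2 by rewrite sqr_sqrtr// addr_ge0// sqr_ge0.
have st0 : s ^+ 2 + t ^+ 2 != 0.
  by rewrite gt_eqF// ltr_pwDl ?exprn_even_gt0 ?sqr_ge0.
have u0 : u != 0 by rewrite -sqrf_eq0 u2.
rewrite !normal_pdfE ?mulf_neq0 ?invr_neq0//.
rewrite mulrACA [RHS]mulrACA; congr (_ * _); last first.
  rewrite /normal_fun -!expRD; congr expR.
  rewrite !exprMn exprVn u2; field.
  by rewrite s0 t0 st0.
rewrite /normal_peak -!invfM -!sqrtrM; last 2 first.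
- by rewrite mulrn_wge0// mulr_ge0 ?sqr_ge0 ?pi_ge0.
- by rewrite mulrn_wge0// mulr_ge0 ?sqr_ge0 ?pi_ge0.
congr (Num.sqrt _)^-1.
by rewrite !exprMn exprVn u2; field.
Qed.

(** Conditioning on the first summand gives a double Lebesgue integral; after Tonelli,
    [normal_pdf_mul] leaves the density of the sum times a density in [x] of total mass 1. *)
Lemma normal_prob_add s t B : s != 0 -> t != 0 -> measurable B ->
  (normal_prob 0 s \x normal_prob 0 t)%E ((fun z => z.1 + z.2) @^-1` B) =
  normal_prob 0 (Num.sqrt (s ^+ 2 + t ^+ 2)) B.
Proof.
move=> s0 t0 mB; set u := Num.sqrt _.
have mpdf2 : measurable_fun [set: measurableTypeR R * measurableTypeR R]
    (fun p => (normal_pdf p.1 t p.2)%:E).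
  apply/measurable_EFinP.
  under eq_fun do rewrite normal_pdfE// /normal_fun.
  apply: measurable_funM => //.
  apply: measurableT_comp => //; apply: measurable_funM => //.
  apply: measurable_funN; apply: measurable_funX.
  by apply: measurable_funB.
rewrite /product_measure1/=.
transitivity (\int[normal_prob 0 s]_x normal_prob x t B)%E.
  apply: eq_integral => x _; rewrite [RHS]normal_prob_shift//=.
  congr (normal_prob 0 t _); rewrite /xsection; by apply/seteqP; split => y /=; rewrite inE.
(* The indicator of [B] moves into the integrand, so that [g] is jointly measurable on the whole
   plane and Tonelli applies. *)
pose g (p : measurableTypeR R * measurableTypeR R) : \bar R :=
  ((\1_B p.2)%:E * (normal_pdf p.1 t p.2)%:E)%E.
have mg : measurable_fun setT g.
  apply: emeasurable_funM => //; apply/measurable_EFinP.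
  by apply: measurableT_comp => //; exact: measurable_indic.
have g0 p : (0 <= g p)%E by rewrite /g -EFinM lee_fin mulr_ge0// normal_pdf_ge0.
have NE x : normal_prob x t B = (\int[mu]_z g (x, z))%E.
  rewrite /normal_prob integral_mkcond; apply: eq_integral => z _.
  by rewrite patchE /g indicE; case: ifPn => _; rewrite ?mul1e ?mul0e.
have mN : measurable_fun setT (fun x : measurableTypeR R => normal_prob x t B).
  rewrite (_ : (fun _ => _) = fubini_F mu g); last by apply/funext => x; exact: NE.
  exact: measurable_fun_fubini_tonelli_F.
rewrite ge0_integral_normal_prob//.
pose h (p : measurableTypeR R * measurableTypeR R) : \bar R :=
  (g p * (normal_pdf 0 s p.1)%:E)%E.
have mh : measurable_fun setT h.
  apply: emeasurable_funM => //; apply/measurable_EFinP.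
  by apply: measurableT_comp => //; exact: measurable_normal_pdf.
have h0 p : (0 <= h p)%E by rewrite /h mule_ge0// lee_fin normal_pdf_ge0.
transitivity (\int[mu]_x \int[mu]_z h (x, z))%E.
  apply: eq_integral => x _; rewrite NE -ge0_integralZr//.
  - exact: measurableT_comp mg (pair1_measurable x).
  - by rewrite lee_fin normal_pdf_ge0.
rewrite (@fubini_tonelli _ _ _ _ _ mu mu h)//.
rewrite [RHS]integral_mkcond; apply: eq_integral => z _; rewrite /fubini_G/=.
rewrite patchE; case: ifPn => zB; last first.
  apply: integral0_eq => x _; rewrite /h /g/= indicE (negbTE zB).
  by rewrite !mul0e.
under eq_integral => x _.
  rewrite /h /g/= indicE zB mul1e -EFinM normal_pdf_mul// EFinM; over.
rewrite ge0_integralZl//=.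
- by rewrite integral_normal_pdf mule1.
- exact: measurable_EFin_normal_pdf.
- by move=> x _; rewrite lee_fin normal_pdf_ge0.
- by rewrite lee_fin normal_pdf_ge0.
Qed.

End normal_convolution.

(** * Agreement of signs of two correlated normal variables *)

Section normal_sign.
Context {R : realType}.
Notation mu := (@lebesgue_measure R).
Local Notation symitv r := `](- r)%R, r%R[%classic.
Implicit Types (m s a w x r : R) (B : set (measurableTypeR R)).

Lemma measurable_set_ltr d (T : measurableType d) (f g : T -> R) :
  measurable_fun setT f -> measurable_fun setT g ->
  measurable [set x | f x < g x].
Proof.
move=> mf mg; rewrite -[X in measurable X]setTI.
exact: (measurable_fun_ltr mf mg measurableT (Y := [set true])).
Qed.

Lemma measurable_set_sign d (T : measurableType d) (f : T -> R) (b : bool) :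
  measurable_fun setT f -> measurable [set x | (0 < f x) = b].
Proof.
move=> mf; rewrite -[X in measurable X]setTI.
have mc : measurable_fun [set: T] (fun=> 0 : R) by [].
by apply: (measurable_fun_ltr mc mf measurableT (Y := [set b])).
Qed.

(** The second coordinate of [z] is an increment, so [u] and [v] record the signs before and after
    adding it. *)
Definition quadrant (u v : bool) : set (measurableTypeR R * measurableTypeR R) :=
  [set z | (0 < z.1) = u /\ (0 < z.1 + z.2) = v].

Lemma measurable_quadrant u v : measurable (quadrant u v).
Proof.
by apply: measurableI; apply: measurable_set_sign => //; apply: measurable_funD.
Qed.

Lemma normal_prob_set1 m s x : normal_prob m s [set x] = 0%E.
Proof.
have /null_content_dominatesP := normal_prob_dominates m s.
apply; [exact: measurable_set1|exact: lebesgue_measure_set1].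
Qed.

Lemma normal_probN s B : s != 0 -> measurable B ->
  normal_prob 0 s (-%R @^-1` B) = normal_prob 0 s B.
Proof.
move=> s0 mB; have N1 : -1 != 0 :> R by rewrite oppr_eq0 oner_neq0.
have := normal_prob_affine 0 0 N1 s0 mB.
rewrite mulr0 addr0 mulN1r.
rewrite (_ : normal_prob 0 (- s) B = normal_prob 0 s B); last first.
  apply: eq_integral => x _; rewrite !normal_pdfE ?oppr_eq0//.
  by rewrite /normal_peak /normal_fun sqrrN.
by move=> ->; congr normal_prob; apply/seteqP; split => y /=; rewrite mulN1r addr0.
Qed.

Lemma normal_prob_ray s r : s != 0 ->
  normal_prob 0 s `]-oo, r[ = normal_prob 0 s `]- r, +oo[.
Proof.
move=> s0; rewrite -(normal_probN s0)//; congr normal_prob.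
by apply/seteqP; split => y /=; rewrite !in_itv/= andbT; lra.
Qed.

(** By symmetry one copy of the left ray becomes []-r, +oo[], which splits into the symmetric
    interval and [[r, +oo[]; the latter completes the other copy to the whole line. *)
Lemma normal_prob_ray_double s r : s != 0 -> 0 <= r ->
  (2%:E * normal_prob 0 s `]-oo, r[%classic
   = 1 + normal_prob 0 s (symitv r))%E.
Proof.
move=> s0 r0.
have e1 : (normal_prob 0 s `](- r)%R, +oo[%classic =
    normal_prob 0 s (symitv r) + normal_prob 0 s `[r, +oo[%classic)%E.
  (* At [r = 0] the splitting fails by the single point 0, which has mass zero. *)
  have [->|rN0] := eqVneq r 0.
    rewrite oppr0 set_itvoo0 measure0 add0e -(setU1itv (a := +oo%O) (x := 0) false)//.
    rewrite measureU//; last first.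
      by apply/seteqP; split => y //=; rewrite in_itv/= => -[->]; rewrite ltxx.
    by rewrite [X in (X + _)%E]normal_prob_set1 add0e.
  have {}r0 : 0 < r by rewrite lt_neqAle eq_sym rN0.
  rewrite -measureU//.
    congr normal_prob; apply/seteqP; split => y /=; rewrite !in_itv/= !andbT.
      by move=> ry; case: (ltP y r) => yr; [left; rewrite ry|right].
    by case=> [/andP[]//|]; lra.
  by apply/seteqP; split => y //=; rewrite !in_itv/= andbT => -[/andP[_]]; lra.
have e2 : (normal_prob 0 s `]-oo, r[%classic + normal_prob 0 s `[r, +oo[%classic = 1)%E.
  rewrite -measureU//; last first.
    by apply/seteqP; split => y //=; rewrite !in_itv/= andbT => -[]; lra.
  rewrite -(@probability_setT _ _ _ (normal_prob 0 s)); congr normal_prob.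
  apply/seteqP; split => y //= _; rewrite !in_itv/= andbT.
  by case: (ltP y r) => yr; [left|right].
by rewrite mule_natl mule2n {2}normal_prob_ray// e1 addeCA e2 addeC.
Qed.

Lemma normal_prob_rayE s r : s != 0 -> 0 <= r ->
  (normal_prob 0 s `]-oo, r[%classic
   = (2^-1)%:E + (2^-1)%:E * normal_prob 0 s (symitv r))%E.
Proof.
move=> s0 r0; have := normal_prob_ray_double s0 r0.
have /fineK <- : normal_prob 0 s `]-oo, r[%classic \is a fin_num.
  exact: fin_num_measure.
have /fineK <- : normal_prob 0 s (symitv r) \is a fin_num.
  exact: fin_num_measure.
by rewrite -!EFinM -!EFinD => -[e]; congr EFin; lra.
Qed.

Lemma normal_prob_gt0 s : s != 0 -> normal_prob 0 s `]0, +oo[ = (2^-1)%:E.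
Proof.
move=> s0; have := normal_prob_ray_double s0 (lexx 0).
rewrite normal_prob_ray// oppr0 set_itvoo0 measure0 adde0.
have -> : normal_prob 0 s `]0, +oo[%classic =
    (fine (normal_prob 0 s `]0, +oo[%classic))%:E by rewrite fineK// fin_num_measure.
rewrite -EFinM => -[e]; congr EFin.
by apply: (@mulfI _ 2%R); rewrite ?pnatr_eq0// divff ?pnatr_eq0.
Qed.

Lemma normal_prob_le0 s : s != 0 -> normal_prob 0 s `]-oo, 0] = (2^-1)%:E.
Proof.
move=> s0; rewrite -setCitvr probability_setC// [X in (1 - X)%E]normal_prob_gt0//.
by rewrite -EFinB; congr EFin; field.
Qed.

Lemma normal_prob_itv_scale s a r : 0 < s -> 0 < a ->
  normal_prob 0 s (symitv r) = normal_prob 0 (a * s) (symitv (a * r)).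
Proof.
move=> s0 a0; have := @normal_prob_affine R 0 s a 0 (symitv (a * r)).
rewrite mulr0 addr0 => ->//; rewrite ?gt_eqF//.
congr normal_prob; apply/seteqP; split => y /=; rewrite !in_itv/= addr0.
  by rewrite -mulrN !ltr_pM2l.
by rewrite -mulrN !ltr_pM2l.
Qed.

(** Rescaling the law of deviation [a] to deviation [s] widens the interval by the factor
    [s / a >= 1]. *)
Lemma normal_prob_itv_le a s r : 0 < a -> a <= s ->
  (normal_prob 0 s (symitv r) <= normal_prob 0 a (symitv r))%E.
Proof.
move=> a0 as_; have s0 : 0 < s by exact: lt_le_trans as_.
have [r0|r0] := leP r 0.
  rewrite set_itv_ge ?measure0//.
  by rewrite bnd_simp -leNgt; lra.
rewrite (normal_prob_itv_scale r a0 (divr_gt0 s0 a0)) divfK ?gt_eqF//.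
apply: le_measure; rewrite ?inE//.
apply: subitvP; rewrite subitvE !bnd_simp.
have : r <= s / a * r by rewrite ler_pMl// ler_pdivlMr// mul1r.
by move=> h; rewrite lerN2 h.
Qed.

(* Unimodality: shrinking the standard deviation by [p] multiplies the density
   by at most [1 / p]. *)
Lemma normal_prob_itv_ge w p r : 0 < w -> 0 < p <= 1 ->
  (p%:E * normal_prob 0 (p * w) (symitv r)
   <= normal_prob 0 w (symitv r))%E.
Proof.
move=> w0 /andP[p0 p1]; rewrite /normal_prob -ge0_integralZl//=; last 3 first.
- exact: measurable_EFin_normal_pdf.
- by move=> x _; rewrite lee_fin normal_pdf_ge0.
- by rewrite lee_fin ltW.
apply: ge0_le_integral => //=.
- by move=> x _; rewrite mule_ge0// ?lee_fin ?normal_pdf_ge0// ltW.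
- by apply: measurable_funeM; exact: measurable_EFin_normal_pdf.
- exact: measurable_EFin_normal_pdf.
- move=> x _; rewrite -EFinM lee_fin !normal_pdfE ?gt_eqF ?mulr_gt0//.
  rewrite mulrA ler_pM//.
  + by rewrite mulr_ge0 ?normal_peak_ge0// ltW.
  + exact: normal_fun_ge0.
  + rewrite /normal_peak exprMn -mulrA -mulrnAr sqrtrM ?sqr_ge0// sqrtr_sqr.
    by rewrite gtr0_norm// invfM mulrA divff ?mul1r// gt_eqF.
  + rewrite /normal_fun ler_expR subr0 !mulNr lerN2 ler_wpM2l ?sqr_ge0//.
    rewrite lef_pV2 ?posrE ?mulrn_wgt0 ?exprn_gt0 ?mulr_gt0//.
    rewrite lerMn2r/= exprMn ler_piMl ?sqr_ge0// exprn_ile1//.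
    exact: ltW.
Qed.

Lemma xsection_abs_lt x :
  xsection [set z : measurableTypeR R * measurableTypeR R | `|z.2| < `|z.1|] x =
  symitv `|x|.
Proof.
rewrite /xsection; apply/seteqP; split => y /=; rewrite in_itv/= inE/=;
  by rewrite ltr_norml.
Qed.

Lemma measurable_abs_lt :
  measurable [set z : measurableTypeR R * measurableTypeR R | `|z.2| < `|z.1|].
Proof. by apply: measurable_set_ltr; apply: measurableT_comp. Qed.

Lemma abs_ltI :
  [set z : R * R | `|z.2| < `|z.1|] `&` [set z | `|z.1| < `|z.2|] = set0.
Proof.
by apply/seteqP; split => [[x y]/= []|//]; move=> /lt_trans/[apply]; rewrite ltxx.
Qed.

Lemma abs_lt_eqI :
  ([set z : R * R | `|z.2| < `|z.1|] `|` [set z | `|z.1| < `|z.2|]) `&`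
    [set z | `|z.2| = `|z.1|] = set0.
Proof. by apply/seteqP; split => [[x y]/= [[]] + xy|//]; rewrite xy ltxx. Qed.

Lemma abs_lt_eqU :
  ([set z : R * R | `|z.2| < `|z.1|] `|` [set z | `|z.1| < `|z.2|]) `|`
    [set z | `|z.2| = `|z.1|] = setT.
Proof.
apply/seteqP; split => [//|[x y] _]/=.
by case: (ltgtP `|y| `|x|) => [||->]; [left; left|left; right|right].
Qed.

Lemma measure_half d (T : measurableType d) (M : {measure set T -> \bar R})
    (A B E : set T) :
  measurable A -> measurable B -> measurable E ->
  A `&` B = set0 -> (A `|` B) `&` E = set0 -> (A `|` B) `|` E = setT ->
  M E = 0%E -> M B = M A -> M setT = 1%E -> M A = (2^-1)%:E.
Proof.
move=> mA mB mE AB ABE UT ME MBA M1.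
have : (M A + M A = 1)%E.
  rewrite -[in X in (_ + X)%E]MBA -measureU// -[LHS]adde0 -ME -measureU//.
    by rewrite UT.
  exact: measurableU.
have : M A \is a fin_num.
  rewrite ge0_fin_numE//; apply: (@le_lt_trans _ _ (M setT)).
    by apply: le_measure; rewrite ?inE.
  by rewrite M1 ltry.
move=> /fineK <-; rewrite -EFinD => -[e]; congr EFin.
by move: e; lra.
Qed.

Lemma product_measure_swap (m : {sigma_finite_measure set (measurableTypeR R) -> \bar R})
    (D : set (measurableTypeR R * measurableTypeR R)) :
  measurable D -> (m \x m)%E (swap_pair @^-1` D) = (m \x m)%E D.
Proof.
move=> mD; have msw : measurable_fun setT
    (@swap_pair (measurableTypeR R) (measurableTypeR R)) by exact: measurable_swap.
rewrite [RHS](@product_measure_unique _ _ _ _ _ m m (image_measure (m \x m)%E msw))//.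
move=> A B mA mB; rewrite /= /pushforward (_ : _ @^-1` _ = B `*` A).
  by rewrite product_measure1E// muleC.
by apply/seteqP; split => -[x y] [].
Qed.

Lemma product_probability_setT d1 d2 (T1 : measurableType d1)
    (T2 : measurableType d2) (P1 : probability T1 R) (P2 : probability T2 R) :
  (P1 \x P2)%E setT = 1%E.
Proof.
transitivity (P1 setT * P2 setT)%E.
  by rewrite -product_measure1E// setXTT.
by rewrite !probability_setT mule1.
Qed.

(** The integral is the probability of [|Z| < |Z'|] for independent variables of the same law.
    Swapping them gives the reverse event the same mass, and ties are null because each section of
    the tie event has at most two points. *)
Lemma normal_prob_abs_lt s : s != 0 ->
  (\int[normal_prob 0 s]_x normal_prob 0 s (symitv `|x|))%E = (2^-1)%:E.
Proof.
move=> s0; set D := [set z : measurableTypeR R * measurableTypeR R | `|z.2| < `|z.1|].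
have mD : measurable D := measurable_abs_lt.
pose N : probability (measurableTypeR R) R := normal_prob 0 s.
pose M := (N \x N)%E.
have -> : (\int[N]_x N (symitv `|x|))%E = M D.
  by apply: eq_integral => x _; rewrite /= xsection_abs_lt.
pose E := [set z : measurableTypeR R * measurableTypeR R | `|z.2| = `|z.1|].
have mE : measurable E.
  rewrite (_ : E = ~` (D `|` swap_pair @^-1` D)).
    apply: measurableC; apply: measurableU => //.
    by rewrite -[X in measurable X]setTI; exact: measurable_swap.
  apply/seteqP; split => -[x y] /=; rewrite /D/=.
    by move=> -> []; rewrite ltxx.
  by case: (ltgtP `|y| `|x|) => // _ []; [left|right].
have ME : M E = 0%E.
  apply: integral0_eq => x _; apply/eqP; rewrite /= eq_le measure_ge0 andbT.
  have -> : (0 = N [set x] + N [set (- x)%R])%E.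
    by rewrite /N [X in (X + _)%E]normal_prob_set1 [X in (_ + X)%E]normal_prob_set1 add0e.
  apply: le_trans (measureU2 _ _ _) => //; apply: le_measure; rewrite ?inE//.
  - exact: measurable_xsection.
  - exact: measurableU.
  - move=> y; rewrite /xsection/= inE/= => /eqP; rewrite eqr_norm2.
    by move=> /orP[] /eqP; [left|right].
have msD : measurable (swap_pair @^-1` D : set (measurableTypeR R * measurableTypeR R)).
  by rewrite -[X in measurable X]setTI; exact: measurable_swap.
have eD : M (swap_pair @^-1` D) = M D by exact: product_measure_swap.
exact: (measure_half mD msD mE abs_ltI abs_lt_eqI abs_lt_eqU ME eD
  (product_probability_setT N N)).
Qed.

(** Given [x], the signs agree on a half-line of increments whose mass is that of []-oo, |x|[], that
    is, one half plus half the mass of the symmetric interval. Unimodality passes from deviation [w]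
    to [p * w] at the cost of a factor [p], and monotonicity in the deviation passes from [p * w] to
    [a]. *)
Lemma normal_prob_sign_xsection a w p x : 0 < w -> 0 < p <= 1 -> p * w <= a ->
  ((2^-1)%:E + (2^-1)%:E * (p%:E * normal_prob 0 a (symitv `|x|)) <=
   normal_prob 0 w (xsection (quadrant true true `|` quadrant false false) x))%E.
Proof.
move=> w0 /[dup] p01 /andP[p0 p1] pwa.
have a0 : 0 < a by rewrite (lt_le_trans _ pwa)// mulr_gt0.
pose Nw : probability (measurableTypeR R) R := normal_prob 0 w.
have l1 : ((2^-1)%:E + (2^-1)%:E * (p%:E * normal_prob 0 a (symitv `|x|)) <=
    Nw `]-oo, `|x|%R[%classic)%E.
  rewrite [leRHS]normal_prob_rayE ?gt_eqF// leeD2l// lee_wpmul2l//.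
  apply: le_trans (normal_prob_itv_ge _ w0 p01).
  apply: lee_wpmul2l; first by rewrite lee_fin ltW.
  by apply: normal_prob_itv_le => //; rewrite mulr_gt0.
apply: (le_trans l1).
have [x0|x0] := ltP 0 x.
  rewrite gtr0_norm// [leLHS]normal_prob_ray ?gt_eqF//; apply: le_measure; rewrite ?inE//.
    by apply: measurable_xsection; apply: measurableU; exact: measurable_quadrant.
  move=> y; rewrite /xsection/= in_itv/= andbT inE/= => xy; left; split => //=.
  by rewrite -ltrBlDl sub0r.
rewrite ler0_norm//; apply: le_measure; rewrite ?inE//.
  by apply: measurable_xsection; apply: measurableU; exact: measurable_quadrant.
move=> y; rewrite /xsection/= in_itv/= inE/= => xy; right; split => /=.
  by apply/negbTE; rewrite -leNgt.
by apply/negbTE; rewrite -leNgt; lra.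
Qed.

(** Integrating the sectionwise bound against the law of [x] gives [1/2 + (1/2) * p * (1/2)], the
    last factor coming from [normal_prob_abs_lt]. *)
Lemma normal_prob_sign a w p : 0 < w -> 0 < p <= 1 -> p * w <= a ->
  ((2^-1 + p / 4)%:E <=
    (normal_prob 0 a \x normal_prob 0 w) (quadrant true true `|` quadrant false false))%E.
Proof.
move=> w0 /[dup] p01 /andP[p0 p1] pwa.
have a0 : 0 < a by rewrite (lt_le_trans _ pwa)// mulr_gt0.
pose Na : probability (measurableTypeR R) R := normal_prob 0 a.
pose Nw : probability (measurableTypeR R) R := normal_prob 0 w.
have mN (N : {sigma_finite_measure set (measurableTypeR R) -> \bar R}) :
    measurable_fun setT (fun x : measurableTypeR R => N (symitv `|x|)).
  have := measurable_fun_xsection N measurable_abs_lt.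
  by apply: eq_measurable_fun => x _; rewrite /= xsection_abs_lt.
have mpN : measurable_fun setT
    (fun x : measurableTypeR R => (p%:E * Na (symitv `|x|)))%E.
  by apply: measurable_funeM; exact: mN.
apply: (@le_trans _ _ (\int[Na]_x ((2^-1)%:E + (2^-1)%:E * (p%:E * Na (symitv `|x|))))%E).
  rewrite ge0_integralD//=; last 2 first.
  - by move=> x _; rewrite !mule_ge0// lee_fin// ltW.
  - by apply: measurable_funeM; exact: mpN.
  rewrite ge0_integralZl//=; last by move=> x _; rewrite !mule_ge0// lee_fin// ltW.
  rewrite ge0_integralZl//=; last by rewrite lee_fin ltW.
  rewrite normal_prob_abs_lt ?gt_eqF// integral_cst//.
  rewrite [X in (_ * X + _)%E](probability_setT Na) mule1.
  by rewrite -!EFinM -EFinD lee_fin; lra.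
apply: ge0_le_integral => //=.
- by move=> x _; rewrite adde_ge0// ?lee_fin// !mule_ge0// lee_fin// ltW.
- by apply: emeasurable_funD => //; apply: measurable_funeM; exact: mpN.
- by apply: measurable_fun_xsection; apply: measurableU; exact: measurable_quadrant.
- by move=> x _; exact: normal_prob_sign_xsection.
Qed.

End normal_sign.

(** * Independent families of normal vectors *)

Section product_law.
Context {d1 d2 : measure_display} {T : measurableType d1} {U : measurableType d2}
  {R : realType}.
Variable P : probability T R.

(* Exchanges the coordinates one at a time from the pi-system [G] to the whole
   sigma-algebra. *)
Lemma product_law_unique (C : set T) (n : nat) (V : 'I_n -> T -> U)
    (mu : probability U R) (G : set (set U)) :
  measurable C -> (forall i, measurable_fun setT (V i)) ->
  measurable = <<s G >> -> setI_closed G -> G setT ->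
  (forall B : 'I_n -> set U, (forall i, G (B i)) ->
     P (C `&` [set x | forall i, B i (V i x)]) = (P C * \prod_(i < n) mu (B i))%E) ->
  forall B : 'I_n -> set U, (forall i, measurable (B i)) ->
     P (C `&` [set x | forall i, B i (V i x)]) = (P C * \prod_(i < n) mu (B i))%E.
Proof.
move=> mC mV mG GI GT GE.
have Gm A : G A -> measurable A by move=> GA; rewrite mG; exact: sub_gen_smallest.
(* Coordinates below [j] are constrained by arbitrary measurable sets, the remaining ones by sets of
   [G]. *)
suff H j : (j <= n)%N -> forall B : 'I_n -> set U, (forall i, measurable (B i)) ->
    (forall i : 'I_n, (j <= i)%N -> G (B i)) ->
    P (C `&` [set x | forall i, B i (V i x)]) = (P C * \prod_(i < n) mu (B i))%E.
  by move=> B mB; apply: (H n) => // i; rewrite leqNgt ltn_ord.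
elim: j => [_ B _ GB|j IH jn B mB GB]; first by apply: GE => i; exact: GB.
pose j' := Ordinal jn.
pose D := C `&` [set x | forall i, i != j' -> B i (V i x)].
have mD : measurable D.
  apply: measurableI => //.
  rewrite (_ : [set x | _] = \bigcap_(i in [set i | i != j']) (V i @^-1` B i)).
    apply: fin_bigcap_measurable => [|i _]; first exact: finite_finset.
    by rewrite -[X in measurable X]setTI; exact: mV.
  by apply/seteqP; split => x /=; apply.
pose c := \prod_(i < n | i != j') fine (mu (B i)).
have c0 : 0 <= c by apply: prodr_ge0 => i _; exact: fine_ge0.
pose k := NngNum (mulr_ge0 (fine_ge0 (measure_ge0 P C)) c0).
have fmu A : measurable A -> mu A \is a fin_num by move=> mA; exact: fin_num_measure.
pose Bj (A : set U) i := if i == j' then A else B i.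
have mBj A i : measurable A -> measurable (Bj A i) by rewrite /Bj; case: ifP.
have DE A : [set x | D x /\ A (V j' x)] = C `&` [set x | forall i, Bj A i (V i x)].
  apply/seteqP; split => x /=.
    move=> [[Cx Bx] Ax]; split=> // i; rewrite /Bj; case: eqVneq => [->//|ij].
    exact: Bx.
  move=> [Cx Bx]; split; last by have := Bx j'; rewrite /Bj eqxx.
  by split=> // i ij; have := Bx i; rewrite /Bj (negbTE ij).
have prodE A : measurable A ->
    (P C * \prod_(i < n) mu (Bj A i) = k%:num%:E * mu A)%E.
  move=> mA; rewrite (bigD1 j')//= /Bj eqxx EFinM fineK ?fin_num_measure//.
  rewrite -muleA; congr (_ * _)%E; rewrite muleC; congr (_ * _)%E.
  rewrite /c (big_morph EFin EFinM erefl); apply: eq_bigr => i ij.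
  by rewrite (negbTE ij) fineK ?fmu.
(* With the other constraints frozen in [D], both sides are finite measures in the constraint on
   coordinate [j']; the induction hypothesis makes them agree on [G]. *)
have m12 A : measurable A ->
    image_measure (mrestr P mD) (mV j') A = mscale k mu A.
  move=> mA; apply: (measure_unique G (fun=> setT)) => //.
  - by rewrite bigcup_const.
  - move=> A' GA' /=; rewrite /mscale/= /pushforward /mrestr.
    rewrite setIC [X in P X](DE A') -prodE; last exact: Gm.
    apply: IH; first exact: ltnW.
      by move=> i; apply: mBj; exact: Gm.
    move=> i ji; rewrite /Bj; case: eqVneq => // ij; apply: GB.
    rewrite ltn_neqAle ji andbT; apply: contra ij => /eqP e.
    by apply/eqP/val_inj.
  - move=> _; rewrite /= /pushforward /mrestr preimage_setT setTI.
    by rewrite (le_lt_trans (probability_le1 _ _)) ?ltry.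
have := m12 _ (mB j'); rewrite /= /mscale/= /pushforward /mrestr setIC [X in P X](DE _).
rewrite -prodE//.
have -> : Bj (B j') = B by apply/funext => i; rewrite /Bj; case: eqVneq => // ->.
by [].
Qed.

End product_law.

Section rectangles.
Context {d1 d2 : measure_display} {T1 : measurableType d1} {T2 : measurableType d2}.

Definition rectangles : set (set (T1 * T2)) :=
  [set A `*` A' | A in measurable & A' in measurable].

Lemma setI_closed_rectangles : setI_closed rectangles.
Proof.
move=> _ _ [A1 mA1 [A2 mA2 <-]] [A3 mA3 [A4 mA4 <-]].
exists (A1 `&` A3); first exact: measurableI.
by exists (A2 `&` A4); [exact: measurableI|rewrite setXI].
Qed.

Lemma rectangles_setT : rectangles setT.
Proof. by exists setT => //; exists setT => //; rewrite setXTT. Qed.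

Lemma rectangles_choice (I : Type) (D : I -> set (T1 * T2)) :
  (forall i, rectangles (D i)) ->
  exists (A : I -> set T1) (A' : I -> set T2),
    [/\ forall i, measurable (A i), forall i, measurable (A' i) &
        D = fun i => A i `*` A' i].
Proof.
move=> DE.
have /choice[A AE] : forall i, exists A : set T1 * set T2,
    [/\ measurable A.1, measurable A.2 & A.1 `*` A.2 = D i].
  by move=> i; have [A1 mA1 [A2 mA2 <-]] := DE i; exists (A1, A2).
exists (fun i => (A i).1), (fun i => (A i).2); split.
- by move=> i; have [] := AE i.
- by move=> i; have [] := AE i.
- by apply/funext => i; have [_ _ ->] := AE i.
Qed.

End rectangles.

(** * Families of independent normal vectors: removing and merging members *)

Section independent_normal_vectors.
Context {disp : measure_display} {T : measurableType disp} {R : realType}.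
Variables (P : probability T R) (d : nat).
Implicit Types (C : set T) (Y : nat -> T -> 'I_d -> R) (v : nat -> R).
Implicit Types (B : 'I_d -> set (measurableTypeR R)).

Lemma measurable_box d' (U : measurableType d') B (V : 'I_d -> U -> R) :
  (forall i, measurable (B i)) -> (forall i, measurable_fun setT (V i)) ->
  measurable [set x | forall i, B i (V i x)].
Proof.
move=> mB mV.
rewrite (_ : [set x | _] = \bigcap_(i in [set: 'I_d]) (V i @^-1` B i)).
  apply: fin_bigcap_measurable => [|i _]; first exact: finite_finset.
  by rewrite -[X in measurable X]setTI; apply: mV => //; exact: mB.
by apply/seteqP; split => x /= h i; [move=> _; exact: h|exact: (h i)].
Qed.

(* The vectors [Y k] are independent of each other and of the event [C], with
   i.i.d. coordinates of law N(0, (v k)^2); [C] collects the constraints on the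
   vectors already removed from the family. *)
Definition centered_normals C Y v :=
  forall n (B : nat -> 'I_d -> set (measurableTypeR R)),
    (forall k i, measurable (B k i)) ->
    P (C `&` [set x | forall k, (k < n)%N -> forall i, B k i (Y k x i)]) =
    (P C * \prod_(k < n) \prod_(i < d) normal_prob 0 (v k) (B k i))%E.

Definition measurable_process Y :=
  forall k i, measurable_fun setT (fun x => Y k x i).

Lemma measurable_boxes Y (n m : nat) (B : nat -> 'I_d -> set (measurableTypeR R)) :
  measurable_process Y -> (forall k i, measurable (B k i)) ->
  measurable [set x | forall k, (k < n)%N -> forall i, B k i (Y (m + k)%N x i)].
Proof.
move=> mY mB.
rewrite (_ : [set x | _] = \bigcap_(k in [set k | (k < n)%N])
    [set x | forall i, B k i (Y (m + k)%N x i)]); last first.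
  by apply/seteqP; split => x h k kn; exact: (h k kn).
apply: fin_bigcap_measurable => [|k _]; first exact: finite_II.
by apply: measurable_box => // i; exact: mY.
Qed.

(** Once the constraint on the first vector sits inside the event, the remaining vectors can be
    summed and constrained in turn. *)
Lemma centered_normals_head C Y v B : centered_normals C Y v ->
  (forall i, measurable (B i)) ->
  P (C `&` [set x | forall i, B i (Y 0 x i)]) =
    (P C * \prod_(i < d) normal_prob 0 (v 0%N) (B i))%E /\
  centered_normals (C `&` [set x | forall i, B i (Y 0 x i)])
    (fun k => Y k.+1) (fun k => v k.+1).
Proof.
move=> CY mB.
have e : P (C `&` [set x | forall i, B i (Y 0 x i)]) =
    (P C * \prod_(i < d) normal_prob 0 (v 0%N) (B i))%E.
  have := CY 1 (fun=> B) (fun=> mB); rewrite big_ord_recl big_ord0 mule1 => <-.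
  congr (P (_ `&` _)); apply/seteqP; split => x /= h; last exact: h.
  by move=> [|//] _.
split; [exact: e|move=> n B' mB'].
rewrite e -muleA; have := CY n.+1 (fun k => if k is k'.+1 then B' k' else B).
rewrite big_ord_recl /= => <-; last by case.
rewrite -setIA; congr (P (_ `&` _)); apply/seteqP; split => x /=.
  by move=> [h0 h] [|k] kn; [exact: h0|exact: h].
by move=> h; split=> [|k kn]; [exact: (h 0%N)|exact: (h k.+1)].
Qed.

(** Generic in [V], so that the same reindexing acts on the vectors and on their standard
    deviations. *)
Definition merge_head {V : Type} (add : V -> V -> V) (s : nat -> V) (k : nat) : V :=
  if k is k'.+1 then s k'.+2 else add (s 0%N) (s 1%N).

(** The joint law of the coordinate pairs of [Y 0] and [Y 1] is known on rectangles.
    [product_law_unique] extends it to the event that the sum lies in a given set, where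
    [normal_prob_add] applies. *)
Lemma centered_normals_merge C Y v : measurable C -> measurable_process Y ->
  v 0%N != 0 -> v 1%N != 0 -> centered_normals C Y v ->
  centered_normals C
    (merge_head (fun y z x i => y x i + z x i) Y)
    (merge_head (fun s t => Num.sqrt (s ^+ 2 + t ^+ 2)) v).
Proof.
move=> mC mY v0 v1 CY [|n] B mB.
  have := CY 0%N B mB; rewrite !big_ord0 => <-; congr (P (_ `&` _)).
  by apply/seteqP; split.
(* [D] collects the constraints on the unmerged vectors; merging lowers indices by one, so [Y k.+2]
   meets [B k.+1]. *)
pose D := C `&` [set x | forall k, (k < n)%N -> forall i, B k.+1 i (Y k.+2 x i)].
have mD : measurable D.
  apply: measurableI => //.
  exact: (measurable_boxes n 2 mY (B := fun k => B k.+1)).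
pose mu : probability (measurableTypeR R * measurableTypeR R)%type R :=
  (normal_prob 0 (v 0%N) \x normal_prob 0 (v 1%N))%E.
pose V i x : measurableTypeR R * measurableTypeR R := (Y 0%N x i, Y 1%N x i).
have mV i : measurable_fun setT (V i).
  by apply: measurable_fun_pair; exact: mY.
pose q := (\prod_(k < n) \prod_(i < d) normal_prob 0 (v k.+2) (B k.+1 i))%E.
have DE A A' : (forall i, measurable (A i)) -> (forall i, measurable (A' i)) ->
    P (D `&` [set x | forall i, (A i `*` A' i) (V i x)]) =
    (P C * (\prod_(i < d) normal_prob 0 (v 0%N) (A i) *
     (\prod_(i < d) normal_prob 0 (v 1%N) (A' i) * q)))%E.
  move=> mA mA'.
  have := CY n.+2 (fun k => match k with 0 => A | 1 => A' | k'.+2 => B k'.+1 end).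
  rewrite !big_ord_recl /= => <-; last by case=> [|[|k]].
  rewrite -setIA; congr (P (_ `&` _)); apply/seteqP; split => x /=.
    by move=> [h0 h] [|[|k]] kn i; [exact: (h i).1|exact: (h i).2|exact: h0].
  move=> h; split=> [k kn|i]; first exact: (h k.+2).
  by split; [exact: (h 0%N)|exact: (h 1%N)].
have PD : P D = (P C * q)%E.
  have := DE (fun=> setT) (fun=> setT) (fun=> measurableT) (fun=> measurableT).
  rewrite !big1 ?mul1e; last 2 first.
  - by move=> i _; exact: (probability_setT (normal_prob 0 (v 1%N))).
  - by move=> i _; exact: (probability_setT (normal_prob 0 (v 0%N))).
  by move=> <-; congr (P _); apply/seteqP; split => [x Dx|x []].
have key := @product_law_unique _ _ _ _ _ P D d V mu
  rectangles mD mV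
  (measurable_prod_measurableType _ _).
have GE (D' : 'I_d -> set (measurableTypeR R * measurableTypeR R)) :
    (forall i, rectangles (D' i)) ->
    P (D `&` [set x | forall i, D' i (V i x)]) = (P D * \prod_(i < d) mu (D' i))%E.
  move=> /rectangles_choice[A [A' [mA mA' ->]]]; rewrite DE//.
  rewrite PD -!muleA; congr (_ * _)%E; rewrite muleA muleC; congr (_ * _)%E.
  rewrite -big_split/=; apply: eq_bigr => i _.
  by rewrite /mu/= product_measure1E.
have := key setI_closed_rectangles rectangles_setT GE (fun i => (fun z => z.1 + z.2) @^-1` B 0%N i).
rewrite PD big_ord_recl /= -/q => {}key.
transitivity (P (D `&` [set x | forall i, B 0%N i (Y 0%N x i + Y 1%N x i)])).
  rewrite -setIA; congr (P (_ `&` _)); apply/seteqP; split => x /=.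
    by move=> h; split=> [k kn|]; [exact: (h k.+1)|exact: (h 0%N)].
  by move=> [h h0] [|k] kn; [exact: h0|exact: h].
rewrite key.
  rewrite -muleA; congr (_ * _)%E; rewrite muleC; congr (_ * _)%E.
  by apply: eq_bigr => i _; exact: normal_prob_add.
move=> i; rewrite -[X in measurable X]setTI.
have madd : measurable_fun [set: measurableTypeR R * measurableTypeR R]
    (fun z => z.1 + z.2 : measurableTypeR R) by exact: measurable_funD.
by apply: madd => //; exact: mB.
Qed.

End independent_normal_vectors.

(** * Joint law of two disjoint partial sums *)

Section sums_of_independent_normals.
Context {disp : measure_display} {T : measurableType disp} {R : realType}.
Variables (P : probability T R) (d : nat).
Implicit Types (C : set T) (Y : nat -> T -> 'I_d -> R) (v : nat -> R).

Lemma centered_normals_scale C Y v (c : nat -> R) :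
  (forall k, c k != 0) -> (forall k, v k != 0) -> centered_normals P C Y v ->
  centered_normals P C (fun k x i => c k * Y k x i) (fun k => c k * v k).
Proof.
move=> c0 v0 CY n B mB.
have mcB k i : measurable ((fun x => c k * x + 0) @^-1` B k i : set (measurableTypeR R)).
  rewrite -[X in measurable X]setTI; have := measurable_affine (c k) 0.
  by apply => //; exact: mB.
have := CY n (fun k i => (fun x => c k * x + 0) @^-1` B k i) mcB.
rewrite [X in P X](_ : _ = C `&` [set x | forall k, (k < n)%N -> forall i, B k i (c k * Y k x i)]).
  move=> ->; congr (_ * _)%E; apply: eq_bigr => k _; apply: eq_bigr => i _.
  have := normal_prob_affine 0 0 (c0 k) (v0 k) (mB k i).
  by rewrite mulr0 addr0 => <-.
by congr (_ `&` _); apply/seteqP; split => x /= h k kn i; have := h k kn i; rewrite addr0.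
Qed.

(** Induction by merging the head pair. The unsummed tail stays in the family, so that a second
    block can be summed afterwards. *)
Lemma centered_normals_sum C Y v n : measurable C -> measurable_process Y ->
  (forall k, 0 < v k) -> centered_normals P C Y v ->
  centered_normals P C
    (fun k x i => if k is k'.+1 then Y (n.+1 + k')%N x i
                  else \sum_(l < n.+1) Y l x i)
    (fun k => if k is k'.+1 then v (n.+1 + k')%N
              else Num.sqrt (\sum_(l < n.+1) v l ^+ 2)).
Proof.
move=> mC mY v0 CY; elim: n => [|n IH].
  rewrite [X in centered_normals P C X](_ : _ = Y); last first.
    apply/funext => -[|k]//; apply/funext => x; apply/funext => i.
    by rewrite big_ord1.
  rewrite [X in centered_normals P C _ X](_ : _ = v)//.
  by apply/funext => -[|k]//; rewrite big_ord1 sqrtr_sqr gtr0_norm.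
have s0 : 0 < \sum_(l < n.+1) v l ^+ 2.
  rewrite big_ord_recl ltr_pwDl ?exprn_gt0//.
  by apply: sumr_ge0 => i _; rewrite sqr_ge0.
set Y' := (X in centered_normals P C X) in IH.
set v' := (X in centered_normals P C _ X) in IH.
have mY' : measurable_process Y'.
  by move=> [|k] i; [apply: measurable_sum => l; exact: mY|exact: mY].
have v0' : v' 0%N != 0 by rewrite /v' gt_eqF// sqrtr_gt0.
have v1' : v' 1%N != 0 by rewrite /v' gt_eqF.
have := centered_normals_merge mC mY' v0' v1' IH.
set Y'' := merge_head _ Y'; set v'' := merge_head _ v'.
rewrite (_ : Y'' = fun k x i => if k is k'.+1 then Y (n.+2 + k')%N x i
                  else \sum_(l < n.+2) Y l x i); last first.
  apply/funext => -[|k]; apply/funext => x; apply/funext => i.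
    by rewrite /Y'' /Y' /= addn0 [in RHS]big_ord_recr.
  by rewrite /Y'' /Y' /= addnS addSn.
rewrite (_ : v'' = fun k => if k is k'.+1 then v (n.+2 + k')%N
              else Num.sqrt (\sum_(l < n.+2) v l ^+ 2))//.
apply/funext => -[|k]; last by rewrite /v'' /v' /= addnS addSn.
by rewrite /v'' /v' /= addn0 [in RHS]big_ord_recr/= sqr_sqrtr ?ltW.
Qed.

(** The first block is summed and its constraint absorbed into the event, then the second block is
    summed. This gives the law on rectangles, and [product_law_unique] extends it to arbitrary sets
    [D i]. *)
Lemma joint_partial_sums Y v m n (D : 'I_d -> set (measurableTypeR R * measurableTypeR R)) :
  measurable_process Y -> (forall k, 0 < v k) -> centered_normals P setT Y v ->
  (forall i, measurable (D i)) ->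
  P [set x | forall i,
    D i (\sum_(l < n.+1) Y (m.+1 + l)%N x i, \sum_(l < m.+1) Y l x i)] =
  (\prod_(i < d)
     (normal_prob 0 (Num.sqrt (\sum_(l < n.+1) v (m.+1 + l)%N ^+ 2)) \x
      normal_prob 0 (Num.sqrt (\sum_(l < m.+1) v l ^+ 2))) (D i))%E.
Proof.
move=> mY v0 CY mD.
pose S x i := \sum_(l < n.+1) Y (m.+1 + l)%N x i.
pose W x i := \sum_(l < m.+1) Y l x i.
set a := Num.sqrt _; set w := Num.sqrt _.
pose mu : probability (measurableTypeR R * measurableTypeR R)%type R :=
  (normal_prob 0 a \x normal_prob 0 w)%E.
have box_law (B B' : 'I_d -> set (measurableTypeR R)) :
    (forall i, measurable (B i)) -> (forall i, measurable (B' i)) ->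
    P [set x | forall i, (B i `*` B' i) (S x i, W x i)] =
    (\prod_(i < d) (normal_prob 0 a (B i) * normal_prob 0 w (B' i)))%E.
  move=> mB mB'.
  have [PW CW] := centered_normals_head
    (centered_normals_sum m measurableT mY v0 CY) mB'.
  rewrite setTI /= probability_setT mul1e in PW CW.
  have mW : measurable [set x | forall i, B' i (W x i)].
    apply: measurable_box => // i; apply: measurable_sum => l; exact: mY.
  have mY' : measurable_process (fun k => Y (m.+1 + k)%N).
    by move=> k i; exact: mY.
  have [PS _] := centered_normals_head
    (centered_normals_sum n mW mY' (fun k => v0 (m.+1 + k)%N) CW) mB.
  transitivity (P ([set x | forall i, B' i (W x i)] `&` [set x | forall i, B i (S x i)])).
    congr (P _); apply/seteqP; split => x /=.
      by move=> h; split => i; have [] := h i.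
    by move=> [h' h] i; split; [exact: h|exact: h'].
  rewrite /= PW in PS; rewrite big_split/= muleC; exact: PS.
pose V (i : 'I_d) x : measurableTypeR R * measurableTypeR R := (S x i, W x i).
have mV i : measurable_fun setT (V i).
  by apply: measurable_fun_pair; apply: measurable_sum => l; exact: mY.
have := @product_law_unique _ _ _ _ _ P setT d V mu
  rectangles measurableT mV (measurable_prod_measurableType _ _)
  setI_closed_rectangles rectangles_setT _ D mD.
rewrite setTI probability_setT mul1e; apply.
move=> D' /rectangles_choice[B [B' [mB mB' ->]]].
rewrite setTI mul1e box_law//; apply: eq_bigr => i _.
by rewrite /mu /= product_measure1E.
Qed.

End sums_of_independent_normals.

(** * Total variation and affinity of sign patterns *)

Section hellinger.
Context {R : realType}.

Lemma sqrt_add_le (a b : R) : 0 <= a -> 0 <= b ->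
  Num.sqrt a + Num.sqrt b <= Num.sqrt (2 * (a + b)).
Proof.
move=> a0 b0; rewrite -[leLHS]ger0_norm ?addr_ge0// -sqrtr_sqr ler_sqrt; last first.
  by rewrite mulr_ge0// addr_ge0.
have := sqr_ge0 (Num.sqrt a - Num.sqrt b).
rewrite sqrrB sqrrD !sqr_sqrtr//; lra.
Qed.

(** With [h] the probability of agreement, concavity of the square root gives
    [L ^+ 2 <= 1/2 + sqrt (h * (1 - h))]. Since [h >= 1/2 + p/4], this is at most [1 - p^2/16],
    hence at most [exp (- p^2/16)]. *)
Lemma affinity_le (q : bool -> bool -> R) (p : R) :
  (forall u v, 0 <= q u v) -> \sum_u \sum_v q u v = 1 -> 0 <= p ->
  2^-1 + p / 4 <= q true true + q false false ->
  \sum_u \sum_v Num.sqrt (q u v * 4^-1) <= expR (- (p ^+ 2 / 32)).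
Proof.
move=> q0 q1 p0 qp.
rewrite !big_bool/= in q1 *.
set h := q true true + q false false in qp.
have h'E : q true false + q false true = 1 - h by rewrite /h -q1; ring.
have h0 : 0 <= h by rewrite addr_ge0.
have h'0 : 0 <= 1 - h by rewrite -h'E addr_ge0.
have s4 x : 0 <= x -> Num.sqrt (x * 4^-1) = Num.sqrt x / 2.
  move=> x0; rewrite sqrtrM// (_ : 4^-1 = 2^-1 ^+ 2); last by field.
  by rewrite sqrtr_sqr ger0_norm.
rewrite !s4//.
set L := (X in X <= _).
have LE : L <= (Num.sqrt (2 * h) + Num.sqrt (2 * (1 - h))) / 2.
  have := sqrt_add_le (q0 true true) (q0 false false).
  have := sqrt_add_le (q0 true false) (q0 false true).
  by rewrite h'E -/h /L; lra.
have L0 : 0 <= L by rewrite /L !addr_ge0// mulr_ge0// sqrtr_ge0.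
(* Here [h * (1 - h) <= 1/4 - p^2/16], which is at most the square of the right-hand side; that side
   is nonnegative because [h <= 1] forces [p <= 2]. *)
have hh : Num.sqrt (h * (1 - h)) <= (1 - p ^+ 2 / 8) / 2.
  have B0 : 0 <= 1 - p ^+ 2 / 8 by nra.
  rewrite -[leRHS]ger0_norm ?divr_ge0// -sqrtr_sqr ler_sqrt ?sqr_ge0//; nra.
have L2 : L ^+ 2 <= expR (- (p ^+ 2 / 16)).
  apply: (@le_trans _ _ (1 - p ^+ 2 / 16)); last first.
    by have := expR_ge1Dx (- (p ^+ 2 / 16)).
  apply: (@le_trans _ _ (((Num.sqrt (2 * h) + Num.sqrt (2 * (1 - h))) / 2) ^+ 2)).
    by rewrite lerXn2r ?nnegrE// (le_trans L0).
  rewrite expr_div_n sqrrD !sqr_sqrtr ?mulr_ge0// -sqrtrM ?mulr_ge0//.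
  rewrite (_ : 2 * h * (2 * (1 - h)) = 2 ^+ 2 * (h * (1 - h))); last by ring.
  rewrite sqrtrM ?sqr_ge0// sqrtr_sqr ger0_norm//.
  move: hh; set r := Num.sqrt _; lra.
rewrite -[leLHS]ger0_norm// -sqrtr_sqr.
rewrite (_ : expR (- (p ^+ 2 / 32)) = Num.sqrt (expR (- (p ^+ 2 / 16)))).
  by rewrite ler_sqrt ?expR_ge0.
rewrite (_ : - (p ^+ 2 / 16) = - (p ^+ 2 / 32) * 2%:R); last by field.
by rewrite expRM_natr sqrtr_sqr ger0_norm ?expR_ge0.
Qed.

(** The distance is [x + y] minus twice the minimum, and the minimum is at most the geometric
    mean. *)
Lemma total_variation_affinity (x y : R) : 0 <= x -> 0 <= y ->
  x + y - 2 * Num.sqrt (x * y) <= `|x - y|.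
Proof.
wlog xy : x y / y <= x.
  move=> H x0 y0; have [xy|/ltW xy] := leP y x; first exact: (H x y).
  by rewrite (addrC x) (mulrC x) distrC; exact: (H y x).
move=> x0 y0; rewrite ger0_norm ?subr_ge0//.
suff : y <= Num.sqrt (x * y) by lra.
rewrite -[leLHS]ger0_norm// -sqrtr_sqr ler_sqrt ?mulr_ge0//.
by rewrite expr2 ler_wpM2r.
Qed.

Lemma sqrtr_prod (I : finType) (F : I -> R) : (forall i, 0 <= F i) ->
  Num.sqrt (\prod_i F i) = \prod_i Num.sqrt (F i).
Proof.
move=> F0; elim/big_rec2 : _ => [|i y1 y2 _ IH]; first by rewrite sqrtr1.
by rewrite sqrtrM// IH.
Qed.

Lemma sum_prod_signs (d : nat) (F : bool -> bool -> R) :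
  \sum_(u : {ffun 'I_d -> bool}) \sum_(v : {ffun 'I_d -> bool})
    \prod_(i < d) F (u i) (v i) = (\sum_u \sum_v F u v) ^+ d.
Proof.
under eq_bigr => u _ do rewrite -(bigA_distr_bigA (fun i b => F (u i) b)).
rewrite -(bigA_distr_bigA (fun i b => \sum_v F b v)).
by rewrite prodr_const card_ord.
Qed.

(** Each term is bounded below by [total_variation_affinity]. Both families of weights sum to 1, and
    the affinity factorises over coordinates into a [d]-th power, bounded by [affinity_le]. *)
Lemma sum_signs_affinity (d : nat) (q : bool -> bool -> R) (p : R) :
  (forall u v, 0 <= q u v) -> \sum_u \sum_v q u v = 1 -> 0 <= p ->
  2^-1 + p / 4 <= q true true + q false false ->
  2 * (1 - expR (- (d%:R * (p ^+ 2 / 32)))) <=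
  \sum_(u : {ffun 'I_d -> bool}) \sum_(v : {ffun 'I_d -> bool})
    `|\prod_(i < d) q (u i) (v i) - 4^-1 ^+ d|.
Proof.
move=> q0 q1 p0 qp.
pose f u v := \prod_(i < d) q (u i) (v i).
pose g := 4^-1 ^+ d : R.
have gE : g = \prod_(i < d) 4^-1 by rewrite prodr_const card_ord.
have f0 u v : 0 <= f u v by apply: prodr_ge0.
apply: (@le_trans _ _ (\sum_(u : {ffun 'I_d -> bool}) \sum_(v : {ffun 'I_d -> bool})
    (f u v + g - 2 * Num.sqrt (f u v * g)))); last first.
  apply: ler_sum => u _; apply: ler_sum => v _.
  by apply: total_variation_affinity => //; rewrite /g exprn_ge0.
have -> : \sum_(u : {ffun 'I_d -> bool}) \sum_(v : {ffun 'I_d -> bool})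
    (f u v + g - 2 * Num.sqrt (f u v * g)) =
  1 + 1 - 2 * (\sum_u \sum_v Num.sqrt (q u v * 4^-1)) ^+ d.
  under eq_bigr => u _ do rewrite big_split big_split /= sumrN -mulr_sumr.
  rewrite big_split big_split /= sumrN -mulr_sumr; congr (_ + _ - 2 * _).
  - by rewrite sum_prod_signs q1 expr1n.
  - rewrite gE (sum_prod_signs d (fun _ _ => 4^-1)) !big_bool/=.
    by rewrite (_ : _ + _ = 1) ?expr1n//; field.
  - rewrite -(sum_prod_signs d (fun u v => Num.sqrt (q u v * 4^-1))).
    apply: eq_bigr => u _; apply: eq_bigr => v _.
    by rewrite gE -big_split/= sqrtr_prod// => i; rewrite mulr_ge0.
have : (\sum_u \sum_v Num.sqrt (q u v * 4^-1)) ^+ d <= expR (- (d%:R * (p ^+ 2 / 32))).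
  rewrite -mulrN expRM_natl lerXn2r ?nnegrE ?expR_ge0//.
    by apply: sumr_ge0 => u _; apply: sumr_ge0 => v _; rewrite sqrtr_ge0.
  exact: affinity_le.
lra.
Qed.

End hellinger.

(** * Limits of events *)

Section limits_of_events.
Context {disp : measure_display} {T : measurableType disp} {R : realType}.
Variable P : probability T R.

Lemma cvg_probability_ae (A_ : nat -> set T) (A : set T) :
  (forall n, measurable (A_ n)) -> measurable A ->
  {ae P, forall x, \forall n \near \oo, A_ n x <-> A x} ->
  P (A_ n) @[n --> \oo] --> P A.
Proof.
move=> mA_ mA A_A.
have [] := @dominated_convergence _ _ _ P setT measurableT
  (fun n x => (\1_(A_ n) x)%:E) (fun x => (\1_A x)%:E) (cst 1%E).
- by move=> n; apply/measurable_EFinP; exact: measurable_indic.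
- by apply/measurable_EFinP; exact: measurable_indic.
- apply: filterS A_A => x A_A _; apply: cvg_near_cst.
  apply: filterS A_A => n A_A; rewrite !indicE.
  suff -> : (x \in A_ n) = (x \in A) by [].
  by apply/idP/idP => /set_mem/A_A/mem_set.
- apply/integrableP; split => //.
  by rewrite integral_cst//= normr1 mul1e probability_setT ltry.
- apply: aeW => x n _ /=; rewrite lee_fin indicE ger0_norm// lern1.
  exact: leq_b1.
move=> _ _; rewrite integral_indic// setIT.
by under eq_fun do rewrite integral_indic// setIT.
Qed.

(** On the zero set of [f], almost every point eventually satisfies [|f_ n x| < e], so that set has
    mass at most [K * e] for every [e > 0]. *)
Lemma limit_neq0 (f_ : nat -> T -> R) (f : T -> R) (K : R) :
  (forall n, measurable_fun setT (f_ n)) -> measurable_fun setT f ->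
  {ae P, forall x, f_ ^~ x @ \oo --> f x} ->
  (forall n e, 0 < e -> (P [set x | `|f_ n x| < e]%R <= (K * e)%:E)%E) ->
  {ae P, forall x, f x != 0}.
Proof.
move=> mf_ mf f_f PK.
have mZ : measurable [set x | f x = 0].
  by rewrite -[X in measurable X]setTI; exact: (mf measurableT [set 0]).
have mU_ n e : measurable [set x | `|f_ n x| < e].
  by apply: measurable_set_ltr => //; apply: measurableT_comp.
exists [set x | f x = 0]; split => //; last by move=> x /negP/negPn/eqP.
apply/eqP; rewrite eq_le measure_ge0 andbT; apply/lee_addgt0Pr => e e0.
rewrite add0e.
(* Dividing by [|K| + 1] keeps the divisor positive whatever the value of [K]. *)
pose e' := e / (`|K| + 1).
have K1 : 0 < `|K| + 1 by rewrite ltr_wpDl.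
have e'0 : 0 < e' by rewrite divr_gt0.
have Ke : K * e' <= e.
  rewrite /e' mulrCA ler_piMr ?(ltW e0)// ler_pdivrMr// mul1r.
  by rewrite (le_trans (ler_norm _))// lerDl.
pose A_ n := [set x | f x = 0] `&` [set x | `|f_ n x| < e'].
have mA_ n : measurable (A_ n) by exact: measurableI.
have PA : P (A_ n) @[n --> \oo] --> P [set x | f x = 0].
  apply: cvg_probability_ae => //; apply: filterS f_f => x f_fx.
  have [fx0|fx0] := eqVneq (f x) 0; last first.
    by apply: nearW => n; split => [[]|] //= fx; rewrite fx eqxx in fx0.
  have /cvgrPdist_lt/(_ _ e'0) := f_fx.
  apply: filterS => n; rewrite fx0 sub0r normrN => fne.
  by split => [[]|] //=.
rewrite -(cvg_lim _ PA)//; apply: lime_le; first by apply/cvg_ex; eexists; exact: PA.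
apply: nearW => n; apply: (@le_trans _ _ (P [set x | `|f_ n x| < e']%R)).
  by apply: le_measure; rewrite ?inE//; exact: subIsetr.
by apply: (le_trans (PK n _ e'0)); rewrite lee_fin.
Qed.

Lemma eventually_sign (u_ : nat -> R) (u : R) (b : bool) : u != 0 ->
  u_ @ \oo --> u -> \forall n \near \oo, ((0 < u_ n) = b) <-> ((0 < u) = b).
Proof.
move=> u0 u_u.
have /cvgrPdist_lt/(_ `|u|) := u_u; rewrite normr_gt0 => /(_ u0).
apply: filterS => n un.
suff -> : (0 < u_ n) = (0 < u) by [].
have [up|un0|uz] := ltgtP 0 u; last by rewrite -uz eqxx in u0.
  by move: un; rewrite (gtr0_norm up) ltr_distl => /andP[_]; lra.
apply/negbTE; rewrite -leNgt.
by move: un; rewrite (ltr0_norm un0) ltr_distl; lra.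
Qed.

End limits_of_events.

(** * Small balls and quadrants under the normal laws *)

Section truncated_signs.
Context {R : realType}.
Implicit Types (a w s e : R).

Lemma normal_prob_half s (b : bool) : s != 0 ->
  normal_prob 0 s [set x | (0 < x) = b] = (2^-1)%:E.
Proof.
move=> s0; case: b.
  rewrite -(normal_prob_gt0 s0); congr normal_prob.
  by apply/seteqP; split => x /=; rewrite in_itv/= andbT.
rewrite -(normal_prob_le0 s0); congr normal_prob.
by apply/seteqP; split => x /=; rewrite in_itv/= leNgt; [move=> ->|move/negbTE].
Qed.

(** The deviation is first lowered to [s0], whose density is bounded by its peak. The bound is
    uniform in [s >= s0], hence later uniform in the truncation level. *)
Lemma normal_prob_small s s0 e : 0 < s0 -> s0 <= s -> 0 < e ->
  (normal_prob 0 s [set x | `|x| < e]%R <= (normal_peak s0 * 2 * e)%:E)%E.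
Proof.
move=> s00 s0s e0; have sp : 0 < s by exact: lt_le_trans s0s.
rewrite (_ : [set x | _] = `](- e)%R, e[%classic); last first.
  by apply/seteqP; split => x /=; rewrite in_itv/= ltr_norml.
apply: (le_trans (normal_prob_itv_le e s00 s0s)).
apply: (@le_trans _ _ (\int[lebesgue_measure]_(x in `](- e)%R, e[%classic) (normal_peak s0)%:E)%E).
  apply: ge0_le_integral => //=.
  - by move=> x _; rewrite lee_fin normal_pdf_ge0.
  - exact: measurable_EFin_normal_pdf.
  - by move=> x _; rewrite lee_fin normal_pdf_ub// gt_eqF.
rewrite integral_cst//= lebesgue_measure_itv/= lte_fin.
by rewrite gtrN// -EFinB -EFinM lee_fin; lra.
Qed.

Section quadrants.
Variables a w : R.
Hypotheses (a0 : 0 < a) (w0 : 0 < w).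
Let M : probability (measurableTypeR R * measurableTypeR R)%type R :=
  (normal_prob 0 a \x normal_prob 0 w)%E.
Let u := Num.sqrt (a ^+ 2 + w ^+ 2).

Lemma product_normal_fst (B : set (measurableTypeR R)) : measurable B ->
  M (fst @^-1` B) = normal_prob 0 a B.
Proof.
move=> mB; rewrite (_ : _ @^-1` _ = B `*` setT).
  rewrite /M/= product_measure1E//.
  by rewrite [X in (_ * X)%E](probability_setT (normal_prob 0 w)) mule1.
by apply/seteqP; split => z //= [].
Qed.

Lemma product_normal_add (B : set (measurableTypeR R)) : measurable B ->
  M ((fun z => z.1 + z.2) @^-1` B) = normal_prob 0 u B.
Proof. by move=> mB; apply: normal_prob_add => //; rewrite gt_eqF. Qed.

Lemma product_normal_sign1 b : M [set z | (0 < z.1) = b] = (2^-1)%:E.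
Proof.
rewrite -(normal_prob_half b (lt0r_neq0 a0)).
rewrite -[LHS]/(M (fst @^-1` [set x | (0 < x) = b])) product_normal_fst//.
exact: (@measurable_set_sign _ _ (measurableTypeR R) id).
Qed.

Lemma product_normal_sign2 b : M [set z | (0 < z.1 + z.2) = b] = (2^-1)%:E.
Proof.
have u0 : u != 0 by rewrite gt_eqF// sqrtr_gt0 ltr_pwDl ?exprn_gt0 ?sqr_ge0.
rewrite -(normal_prob_half b u0).
rewrite -[LHS]/(M ((fun z => z.1 + z.2) @^-1` [set x | (0 < x) = b])) product_normal_add//.
exact: (@measurable_set_sign _ _ (measurableTypeR R) id).
Qed.

Let fM b c : M (quadrant b c) \is a fin_num.
Proof. by apply: fin_num_measure; exact: measurable_quadrant. Qed.

Lemma quadrant_sum : \sum_b \sum_c fine (M (quadrant b c)) = 1.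
Proof.
have h b : \sum_c fine (M (quadrant b c)) = 2^-1.
  rewrite big_bool; transitivity (fine (M (quadrant b true) + M (quadrant b false)))%E.
    exact: esym (fineD (fM b true) (fM b false)).
  rewrite -measureU//; try exact: measurable_quadrant.
    rewrite (_ : _ `|` _ = [set z | (0 < z.1) = b]).
      exact: (congr1 fine (product_normal_sign1 b)).
    apply/seteqP; split => z /=; first by move=> [] [].
    by move=> zb; case: (boolP (0 < z.1 + z.2)) => [|/negbTE] h; [left|right].
  by apply/seteqP; split => [z [[_ h] [_]]|//]; rewrite h.
by under eq_bigr do rewrite h; rewrite big_bool/=; field.
Qed.

Lemma quadrant_agree p : 0 < p <= 1 -> p * w <= a ->
  2^-1 + p / 4 <= fine (M (quadrant true true)) + fine (M (quadrant false false)).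
Proof.
move=> p01 pwa; rewrite -lee_fin [leRHS]EFinD !fineK ?fM//.
apply: (le_trans (normal_prob_sign w0 p01 pwa)).
rewrite measureU//; try exact: measurable_quadrant.
by apply/seteqP; split => [z [[h _] []]|//]; rewrite h.
Qed.

End quadrants.
End truncated_signs.

(** * The noise and the autoregression *)

Section noise_law.
Context {disp : measure_display} {T : measurableType disp} {R : realType}.
Variables (P : probability T R) (d : nat).

Lemma normal_prob_normr (m s : R) B : normal_prob m `|s| B = normal_prob m s B.
Proof.
apply: eq_integral => x _; rewrite /normal_pdf normr_eq0.
by rewrite /normal_peak /normal_fun real_normK// num_real.
Qed.

Lemma measurable_fun_tnth (Y : {mfun T >-> d.-tuple R}) i :
  measurable_fun setT (fun x => tnth (Y x) i).
Proof.
by apply: (measurableT_comp (f := fun t : d.-tuple R => tnth t i)) => //; exact: measurable_tnth.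
Qed.

Lemma covariance_ae_cst (X Y : T -> R) (m : R) :
  measurable_fun setT X -> measurable_fun setT Y ->
  {ae P, forall x, X x = m} -> covariance P X Y = 0%E.
Proof.
move=> mX mY Xm.
have EX : ('E_P[X] = m%:E)%E.
  rewrite unlock (ae_eq_integral (cst m%:E))//=.
  - by rewrite integral_cst// [X in (_ * X)%E]probability_setT mule1.
  - exact/measurable_EFinP.
  - by apply: filterS Xm => x + _ => ->.
rewrite unlock EX /= unlock.
rewrite (ae_eq_integral (cst 0%E))//=.
- by rewrite integral_cst// mul0e.
- apply/measurable_EFinP; apply: measurable_funM; exact: measurable_funB.
- by apply: filterS Xm => x Xx _; rewrite /= mulrfctE/= Xx subrr mul0r.
Qed.

(** If [s] vanished, coordinate [i] would be almost surely constant and row [i] of the covariance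
    matrix zero, against invertibility. *)
Lemma nondegenerate_gaussian_component (Y : {mfun T >-> d.-tuple R}) (i : 'I_d) :
  nondegenerate_gaussian P Y ->
  exists m s : R, 0 < s /\ forall B : set (measurableTypeR R), measurable B ->
    P ((fun x => tnth (Y x) i) @^-1` B) = normal_prob m s B.
Proof.
move=> [gY cov_unit].
have [m [s ms]] := gY (fun k => (k == i)%:R).
have sumE : (fun w => \sum_(k < d) (k == i)%:R * tnth (Y w) k) = fun w => tnth (Y w) i.
  apply/funext => w; rewrite (bigD1 i)//= eqxx mul1r big1 ?addr0// => k /negbTE ->.
  by rewrite mul0r.
rewrite sumE in ms.
have s0 : s != 0.
  apply/negP => /eqP s0; rewrite s0 eqxx in ms.
  have Ym : {ae P, forall x, tnth (Y x) i = m}.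
    exists ((fun x => tnth (Y x) i) @^-1` ~` [set m]); split.
    - rewrite -[X in measurable X]setTI; apply: measurable_fun_tnth => //.
      exact: measurableC.
    - by rewrite ms; [rewrite diracE memNset//= => /(_ erefl)|exact: measurableC].
    - by [].
  have := mulmxV cov_unit => /matrixP/(_ i i).
  rewrite !mxE eqxx big1 => [/eqP|j _]; first by rewrite eq_sym oner_eq0.
  by rewrite mxE (covariance_ae_cst _ _ Ym) ?mul0r//; exact: measurable_fun_tnth.
(* The deviation in [gaussian_rv] may be negative; its sign does not affect the law. *)
exists m, `|s|; split; first by rewrite normr_gt0.
by move=> B mB; rewrite normal_prob_normr ms// (negbTE s0).
Qed.

(** Identical distribution in time reduces to time 0; independence and identical distribution of the
    components then give the product of copies of one coordinate's law. *)
Lemma iid_gaussian_box (E : int -> {mfun T >-> d.-tuple R}) :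
  (0 < d)%N -> iid P (fun t w => E t w) -> nondegenerate_gaussian P (E 0) ->
  iid P (fun (i : 'I_d) w => tnth (E 0 w) i) ->
  exists m s : R, 0 < s /\ forall t (B : 'I_d -> set (measurableTypeR R)),
    (forall i, measurable (B i)) ->
    P [set x | forall i, B i (tnth (E t x) i)] = (\prod_(i < d) normal_prob m s (B i))%E.
Proof.
move=> d0 [_ idE] ngE [indC idC].
have [m [s [s0 ms]]] := nondegenerate_gaussian_component (Ordinal d0) ngE.
exists m, s; split=> // t B mB.
have mbox : measurable [set y : d.-tuple R | forall i, B i (tnth y i)].
  by apply: measurable_box => // i; exact: measurable_tnth.
rewrite -[LHS]/(P (E t @^-1` [set y | forall i, B i (tnth y i)])).
rewrite (idE t 0)//.
have := indC (enum 'I_d) B (enum_uniq _) mB.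
rewrite big_enum/= => indC'.
transitivity (P (\bigcap_(i in [set` enum 'I_d]) (fun w => tnth (E 0 w) i) @^-1` B i)).
  congr (P _); apply/seteqP; split => x /= h i; first by move=> _; exact: h.
  by apply: h => /=; rewrite mem_enum.
rewrite indC'; apply: eq_bigr => i _.
transitivity (P ((fun x => tnth (E 0 x) (Ordinal d0)) @^-1` B i)).
  exact: (idC i _ _ (mB i)).
exact: (ms _ (mB i)).
Qed.

Lemma centered_noise (E : int -> {mfun T >-> d.-tuple R}) :
  (0 < d)%N -> iid P (fun t w => E t w) -> nondegenerate_gaussian P (E 0) ->
  iid P (fun (i : 'I_d) w => tnth (E 0 w) i) ->
  exists m s : R, 0 < s /\ forall t,
    centered_normals P setT (fun k x i => tnth (E (t - k%:Z) x) i - m) (fun=> s).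
Proof.
move=> d0 iidE ngE iidC; have [m [s [s0 box]]] := iid_gaussian_box d0 iidE ngE iidC.
exists m, s; split=> // t n B mB.
pose B' k i := (fun x => 1 * x - m) @^-1` B k i : set (measurableTypeR R).
have mB' k i : measurable (B' k i).
  rewrite -[X in measurable X]setTI; have := measurable_affine 1 (- m).
  by apply => //; exact: mB.
have mbox k : measurable [set y : d.-tuple R | forall i, B' k i (tnth y i)].
  by apply: measurable_box => // i; exact: measurable_tnth.
(* The family [k] runs backwards in time from [t]; the absolute value of [t - u] recovers the index
   [k] from the time [u = t - k]. *)
have := iidE.1 [seq t - k%:Z | k <- iota 0 n]
  (fun u => [set y | forall i, B' (absz (t - u)%R) i (tnth y i)]) _ (fun u => mbox _).
have inj : injective (fun k : nat => t - k%:Z).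
  by move=> a b /addrI/oppr_inj[].
rewrite map_inj_uniq// iota_uniq big_map => /(_ isT).
have absE (k : nat) : absz (t - (t - k%:Z))%R = k by rewrite opprB addrC subrK.
rewrite setTI probability_setT mul1e => indE.
transitivity (P (\bigcap_(u in [set` [seq t - k%:Z | k <- iota 0 n]])
   E u @^-1` [set y | forall i, B' (absz (t - u)%R) i (tnth y i)])).
  congr (P _); apply/seteqP; split => x /= h.
    move=> u /mapP[k]; rewrite mem_iota add0n => kn -> i /=.
    by rewrite /B' absE/= mul1r; exact: h.
  move=> k kn i; have := h (t - k%:Z); rewrite /= /B' absE/=.
  move=> /(_ _ i); rewrite mul1r; apply.
  by apply/mapP; exists k => //; rewrite mem_iota.
rewrite indE -[n in iota 0 n]subn0 -/(index_iota 0 n) big_mkord.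
apply: eq_bigr => k _; rewrite absE.
transitivity (P [set x | forall i, B' k i (tnth (E (t - k%:Z) x) i)]); first by [].
rewrite (box _ _ (mB' k)); apply: eq_bigr => i _.
have := normal_prob_affine m (- m) (oner_neq0 R) (lt0r_neq0 s0) (mB k i).
by rewrite !mul1r subrr => ->.
Qed.

End noise_law.

(** * Sign patterns as partitions, and their truncated laws *)

Section sign_events.
Context {disp : measure_display} {T : measurableType disp} {R : realType}.
Variables (P : probability T R).

(** Enumerating the index types turns partitions indexed by sign patterns into the ordinal-indexed
    ones of [beta_coef]. *)
Lemma beta_coef_ge (A B : set (set T)) (U V : finType) (F : U -> set T) (G : V -> set T) :
  partition [set: U] F setT -> (forall u, A (F u)) ->
  partition [set: V] G setT -> (forall v, B (G v)) ->
  ((2^-1)%:E * \sum_u \sum_v `|P (F u `&` G v) - P (F u) * P (G v)| <=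
   beta_coef P A B)%E.
Proof.
have part_enum (W : finType) (H : W -> set T) : partition [set: W] H setT ->
    partition [set: 'I_#|W|] (fun i => H (enum_val i)) setT.
  move=> [cH tH H0]; split.
  - rewrite -cH; apply/seteqP; split => x [i _ Hx].
      by exists (enum_val i).
    by exists (enum_rank i) => //; rewrite enum_rankK.
  - move=> i j _ _ Hij; apply: enum_val_inj; exact: tH.
  - by move=> i _; exact: H0.
move=> pF AF pG BG; apply: ereal_sup_ubound.
exists #|U|, #|V|, (fun i => F (enum_val i)), (fun j => G (enum_val j)); split.
- by split=> [|i]; [exact: part_enum|exact: AF].
- by split=> [|j]; [exact: part_enum|exact: BG].
- congr (_ * _)%E; rewrite (reindex (@enum_val U predT))/=; last first.
    by apply/onW_bij; exact: enum_val_bij.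
  apply: eq_bigr => i _; rewrite (reindex (@enum_val V predT))//=.
  by apply/onW_bij; exact: enum_val_bij.
Qed.

Variable d : nat.
Implicit Types (X : T -> 'I_d -> R) (u : {ffun 'I_d -> bool}).

Definition sign_event X u := [set x | forall i, (0 < X x i) = u i].

Lemma measurable_sign_event X u : (forall i, measurable_fun setT (X ^~ i)) ->
  measurable (sign_event X u).
Proof.
move=> mX; apply: (measurable_box (B := fun i => [set y | (0 < y) = u i]))=> //.
by move=> i; exact: (@measurable_set_sign _ _ (measurableTypeR R) id).
Qed.

Lemma sign_event_partition X : (forall u, sign_event X u !=set0) ->
  partition [set: {ffun 'I_d -> bool}] (sign_event X) setT.
Proof.
move=> X0; split=> //.
- apply/seteqP; split => x // _; exists [ffun i => 0 < X x i] => // i.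
  by rewrite ffunE.
- by move=> u v _ _ [x [ux vx]]; apply/ffunP => i; rewrite -ux -vx.
Qed.

Section truncation.
Variables (Y : nat -> T -> 'I_d -> R) (v : nat -> R) (m n : nat).
Hypotheses (mY : measurable_process Y) (v0 : forall k, 0 < v k).
Hypothesis Yv : centered_normals P setT Y v.
(** In the application [Y] lists weighted noise backwards from the later time: [W] gathers the
    innovations after the earlier time, and [S] truncates the contribution of the older noise. *)
Let S x i := \sum_(l < n.+1) Y (m.+1 + l)%N x i.
Let W x i := \sum_(l < m.+1) Y l x i.
Let a := Num.sqrt (\sum_(l < n.+1) v (m.+1 + l)%N ^+ 2).
Let w := Num.sqrt (\sum_(l < m.+1) v l ^+ 2).
Let M : probability (measurableTypeR R * measurableTypeR R)%type R :=
  (normal_prob 0 a \x normal_prob 0 w)%E.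

(** One term of each sum suffices, and it gives bounds that do not depend on [n]. *)
Lemma truncation_scale_ge : v m.+1 <= a /\ v 0%N <= w.
Proof.
split; rewrite -[leLHS]gtr0_norm// -sqrtr_sqr ler_sqrt.
- by rewrite big_ord_recl addn0 lerDl sumr_ge0// => i _; rewrite sqr_ge0.
- by apply: sumr_ge0 => i _; rewrite sqr_ge0.
- by rewrite big_ord_recl lerDl sumr_ge0// => i _; rewrite sqr_ge0.
- by apply: sumr_ge0 => i _; rewrite sqr_ge0.
Qed.

Let a0 : 0 < a. Proof. by apply: lt_le_trans truncation_scale_ge.1. Qed.
Let w0 : 0 < w. Proof. by apply: lt_le_trans truncation_scale_ge.2. Qed.

Lemma truncation_law (D : 'I_d -> set (measurableTypeR R * measurableTypeR R)) :
  (forall i, measurable (D i)) ->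
  P [set x | forall i, D i (S x i, W x i)] = (\prod_(i < d) M (D i))%E.
Proof. exact: joint_partial_sums. Qed.

Lemma truncation_sign1 u : P (sign_event S u) = (2^-1 ^+ d)%:E.
Proof.
transitivity (\prod_(i < d) M [set z | (0 < z.1)%R = u i])%E.
  apply: (truncation_law (D := fun i => [set z | (0 < z.1) = u i])) => i.
  exact: measurable_set_sign.
rewrite (eq_bigr (fun=> (2^-1)%:E)) => [|i _]; last exact: product_normal_sign1.
by rewrite -(big_morph EFin EFinM erefl) prodr_const card_ord.
Qed.

Lemma truncation_sign2 u : P (sign_event (fun x i => S x i + W x i) u) = (2^-1 ^+ d)%:E.
Proof.
transitivity (\prod_(i < d) M [set z | (0 < z.1 + z.2)%R = u i])%E.
  apply: (truncation_law (D := fun i => [set z | (0 < z.1 + z.2) = u i])) => i.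
  by apply: measurable_set_sign; exact: measurable_funD.
rewrite (eq_bigr (fun=> (2^-1)%:E)) => [|i _]; last exact: product_normal_sign2.
by rewrite -(big_morph EFin EFinM erefl) prodr_const card_ord.
Qed.

Lemma truncation_sign12 u u' :
  P (sign_event S u `&` sign_event (fun x i => S x i + W x i) u') =
  (\prod_(i < d) fine (M (quadrant (u i) (u' i))))%:E.
Proof.
transitivity (P [set x | forall i, quadrant (u i) (u' i) (S x i, W x i)]).
  congr (P _); apply/seteqP; split => x /=; first by move=> [h h'] i; split; [exact: h|exact: h'].
  by move=> h; split => i; have [] := h i.
transitivity (\prod_(i < d) M (quadrant (u i) (u' i)))%E.
  apply: (truncation_law (D := fun i => quadrant (u i) (u' i))) => i.
  exact: measurable_quadrant.
rewrite (big_morph EFin EFinM erefl); apply: eq_bigr => i _.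
by rewrite fineK// fin_num_measure//; exact: measurable_quadrant.
Qed.

Lemma truncation_small (phi : R * R -> R) (s s0 e : R) (i : 'I_d) :
  measurable_fun [set: measurableTypeR R * measurableTypeR R] phi ->
  (forall B : set (measurableTypeR R), measurable B ->
    M (phi @^-1` B) = normal_prob 0 s B) ->
  0 < s0 -> s0 <= s -> 0 < e ->
  (P [set x | `|phi (S x i, W x i)| < e]%R <= (normal_peak s0 * 2 * e)%:E)%E.
Proof.
move=> mphi Mphi s00 s0s e0.
pose D j : set (measurableTypeR R * measurableTypeR R) :=
  if j == i then [set z | `|phi z| < e] else setT.
have mD j : measurable (D j).
  rewrite /D; case: ifP => // _.
  by apply: measurable_set_ltr => //; apply: measurableT_comp.
rewrite (_ : [set x | _] = [set x | forall j, D j (S x j, W x j)]).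
  rewrite (truncation_law mD) (bigD1 i)//= big1 ?mule1; last first.
    by move=> j /negbTE ji; rewrite /D ji; exact: (probability_setT M).
  rewrite /D eqxx -[X in (X <= _)%E]/(M (phi @^-1` [set y | `|y| < e])) Mphi.
    exact: normal_prob_small.
  by apply: measurable_set_ltr => //; apply: measurableT_comp.
apply/seteqP; split => x /=; last by move=> /(_ i); rewrite /D eqxx.
by move=> h j; rewrite /D; case: eqVneq => // ->.
Qed.

Lemma truncation_small1 (e : R) (i : 'I_d) : 0 < e ->
  (P [set x | `|S x i| < e]%R <= (normal_peak (v m.+1) * 2 * e)%:E)%E.
Proof.
move=> e0; apply: (@truncation_small fst a) => //.
- by move=> B mB; exact: product_normal_fst.
- exact: truncation_scale_ge.1.
Qed.

Lemma truncation_small2 (e : R) (i : 'I_d) : 0 < e ->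
  (P [set x | `|S x i + W x i| < e]%R <= (normal_peak (v m.+1) * 2 * e)%:E)%E.
Proof.
move=> e0; apply: (@truncation_small (fun z => z.1 + z.2) (Num.sqrt (a ^+ 2 + w ^+ 2))) => //.
- exact: measurable_funD.
- by move=> B mB; exact: product_normal_add.
- apply: (le_trans truncation_scale_ge.1).
  rewrite -[leLHS]gtr0_norm// -sqrtr_sqr ler_sqrt ?lerDl ?sqr_ge0//.
  by rewrite addr_ge0 ?sqr_ge0.
Qed.

Lemma truncation_affinity (p : R) : 0 < p <= 1 -> p * w <= a ->
  2 * (1 - expR (- (d%:R * (p ^+ 2 / 32)))) <=
  \sum_(u : {ffun 'I_d -> bool}) \sum_(u' : {ffun 'I_d -> bool})
    `|fine (P (sign_event S u `&` sign_event (fun x i => S x i + W x i) u')) - 4^-1 ^+ d|.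
Proof.
move=> /[dup] p01 /andP[/ltW p0 p1] pwa.
have q0 b c : 0 <= fine (M (quadrant b c)) by exact: fine_ge0.
have h := sum_signs_affinity d q0 (quadrant_sum w a0) p0 (quadrant_agree w0 p01 pwa).
apply: (le_trans h).
apply: ler_sum => u _; apply: ler_sum => u' _.
by rewrite truncation_sign12.
Qed.

End truncation.
End sign_events.

(** * Passage to the limit for the autoregressive process *)

Section autoregression.
Context {disp : measure_display} {T : measurableType disp} {R : realType}.
Variables (P : probability T R) (d : nat) (kappa : R).
Variables (E X : int -> {RV P >-> d.-tuple R}).
Hypotheses (d_gt0 : (0 < d)%N) (kappa01 : 0 < kappa < 1).
Hypothesis E_iid : iid P (fun t w => E t w).
Hypothesis E_gauss : nondegenerate_gaussian P (E 0).
Hypothesis E_comp_iid : iid P (fun (i : 'I_d) w => tnth (E 0 w) i).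
Hypothesis X_def : forall t : int, {ae P, forall w, forall i : 'I_d,
  series (fun j : nat => kappa ^+ j * tnth (E (t - j%:Z) w) i) @ \oo
    --> tnth (X t w) i}.

Let k0 : 0 < kappa. Proof. by case/andP: kappa01. Qed.
Let k1 : kappa < 1. Proof. by case/andP: kappa01. Qed.

(** Centring the noise subtracts a geometric series, whose sum is the stationary mean
    [mu / (1 - kappa)]. *)
Lemma centered_partial_sums_cvg (mu : R) t :
  {ae P, forall w, forall i : 'I_d,
    (\sum_(l < n) kappa ^+ l * (tnth (E (t - l%:Z) w) i - mu) @[n --> \oo]) -->
    tnth (X t w) i - mu / (1 - kappa)}.
Proof.
apply: filterS (X_def t) => w Xw i.
have geo : series (geometric mu kappa) @ \oo --> mu / (1 - kappa).
  by apply: cvg_geometric_series; rewrite ger0_norm// ltW.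
rewrite (_ : (fun n => _) = (series (fun j : nat => kappa ^+ j * tnth (E (t - j%:Z) w) i)
  \- series (geometric mu kappa))); first exact: cvgB (Xw i) geo.
apply/funext => n /=; rewrite /series/= !big_mkord -sumrB; apply: eq_bigr => l _.
by rewrite /geometric/= mulrBr (mulrC mu).
Qed.

Let measurable_component (Z : {RV P >-> d.-tuple R}) i :
  measurable_fun setT (fun w => tnth (Z w) i).
Proof. exact: measurable_fun_tnth. Qed.

Lemma sigma_gen_sign_event (S : set int) (t : int) (a b : R) (u : {ffun 'I_d -> bool}) :
  S t -> sigma_gen (fun t w => X t w) S
    (sign_event (fun w i => a * (tnth (X t w) i - b)) u).
Proof.
move=> St; apply: sub_sigma_algebra; exists t => //.
exists [set y | forall i, (0 < a * (tnth y i - b)) = u i]; last by rewrite setTI.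
apply: (measurable_box (B := fun i => [set y | (0 < a * (y - b)) = u i])).
  move=> i; apply: (@measurable_set_sign _ _ (measurableTypeR R)).
  by apply: measurable_funM => //; apply: measurable_funB.
by move=> i; exact: measurable_tnth.
Qed.

Lemma beta_mixing_ge_affinity (m : nat) : (0 < m)%N ->
  ((1 - expR (- (d%:R * (kappa ^+ (2 * m) / 32))))%:E <=
    beta_mixing P (fun t w => X t w) m)%E.
Proof.
case: m => // m _.
have [mu [s [s0 noise]]] := centered_noise d_gt0 E_iid E_gauss E_comp_iid.
(* The noise is listed backwards from time [m.+1]: indices up to [m] are the innovations at times
   [1] to [m.+1], later indices belong to times at most 0. *)
pose Y k x i := kappa ^+ k * (tnth (E (m.+1%:Z - k%:Z) x) i - mu).
pose v k := kappa ^+ k * s.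
have kn0 k : 0 < kappa ^+ k by rewrite exprn_gt0.
have v0 k : 0 < v k by rewrite mulr_gt0.
have Yv : centered_normals P setT Y v.
  by apply: centered_normals_scale (noise _) => k; rewrite gt_eqF.
have mY : measurable_process Y.
  move=> k i; apply: measurable_funM => //; apply: measurable_funB => //.
pose S n x i := \sum_(l < n.+1) Y (m.+1 + l)%N x i.
pose W x i := \sum_(l < m.+1) Y l x i.
pose c := mu / (1 - kappa).
(* The positive factor [kappa ^+ m.+1] leaves signs unchanged and makes [f] the limit of [S n]; the
   factor 1 in [g] gives both the shape expected by [sigma_gen_sign_event]. *)
pose f x i := kappa ^+ m.+1 * (tnth (X 0 x) i - c).
pose g x i := 1 * (tnth (X m.+1%:Z x) i - c).
have mS n i : measurable_fun setT (S n ^~ i).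
  by apply: measurable_sum => l; exact: mY.
have mW i : measurable_fun setT (W ^~ i).
  by apply: measurable_sum => l; exact: mY.
have mSW n i : measurable_fun setT (fun x => S n x i + W x i).
  exact: measurable_funD.
have mf i : measurable_fun setT (f ^~ i).
  by apply: measurable_funM => //; apply: measurable_funB.
have mg i : measurable_fun setT (g ^~ i).
  by apply: measurable_funM => //; apply: measurable_funB.
have Sf : {ae P, forall x, forall i, S n x i @[n --> \oo] --> f x i}.
  apply: filterS (centered_partial_sums_cvg mu 0) => x Xx i.
  rewrite (_ : (fun n => _) = (fun n => kappa ^+ m.+1 *
    \sum_(l < n.+1) kappa ^+ l * (tnth (E (0 - l%:Z) x) i - mu))).
    by apply: cvgM; [exact: cvg_cst|rewrite (cvg_shiftS (fun n => \sum_(l < n) _)); exact: Xx].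
  apply/funext => n; rewrite mulr_sumr; apply: eq_bigr => l _.
  rewrite /Y mulrA -exprD; congr (_ * (tnth (E _ x) i - mu)).
  by rewrite PoszD opprD addrA subrr.
have SWg : {ae P, forall x, forall i, S n x i + W x i @[n --> \oo] --> g x i}.
  apply: filterS (centered_partial_sums_cvg mu m.+1%:Z) => x Xx i.
  rewrite /g mul1r (_ : (fun n => _) = (fun n =>
    \sum_(l < n + m.+2) kappa ^+ l * (tnth (E (m.+1%:Z - l%:Z) x) i - mu))).
    by have := Xx i; rewrite -(cvg_shiftn m.+2).
  apply/funext => n; rewrite addrC (_ : (n + m.+2)%N = (m.+1 + n.+1)%N) ?big_split_ord//.
  by rewrite addnS addnC addnS.
have f0 : {ae P, forall x, forall i, f x i != 0}.
  apply: filter_forall => i.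
  apply: (@limit_neq0 _ _ _ P (fun n => S n ^~ i) (f ^~ i)
    (normal_peak (v m.+1) * 2)) => //.
  - by apply: filterS Sf => x /(_ i).
  - by move=> n e e0; exact: truncation_small1.
have g0 : {ae P, forall x, forall i, g x i != 0}.
  apply: filter_forall => i.
  apply: (@limit_neq0 _ _ _ P (fun n x => S n x i + W x i) (g ^~ i)
    (normal_peak (v m.+1) * 2)) => //.
  - by apply: filterS SWg => x /(_ i).
  - by move=> n e e0; exact: truncation_small2.
have signS u : {ae P, forall x, \forall n \near \oo, sign_event (S n) u x <-> sign_event f u x}.
  apply: filterS2 Sf f0 => x Sx fx.
  have : \forall n \near \oo, forall i, ((0 < S n x i) = u i) <-> ((0 < f x i) = u i).
    by apply: filter_forall => i; exact: eventually_sign.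
  by apply: filterS => n h; split => hx i; apply/h.
have signW u : {ae P, forall x, \forall n \near \oo,
    sign_event (fun x i => S n x i + W x i) u x <-> sign_event g u x}.
  apply: filterS2 SWg g0 => x Sx gx.
  have : \forall n \near \oo, forall i, ((0 < S n x i + W x i) = u i) <-> ((0 < g x i) = u i).
    by apply: filter_forall => i; exact: eventually_sign.
  by apply: filterS => n h; split => hx i; apply/h.
have Pf u : P (sign_event f u) = (2^-1 ^+ d)%:E.
  have := cvg_probability_ae (fun n => measurable_sign_event u (mS n))
    (measurable_sign_event u mf) (signS u).
  under eq_fun do rewrite (truncation_sign1 m _ mY v0 Yv).
  by move=> /(cvg_lim _) <-//; rewrite lim_cst.
have Pg u : P (sign_event g u) = (2^-1 ^+ d)%:E.
  have := cvg_probability_ae (fun n => measurable_sign_event u (mSW n))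
    (measurable_sign_event u mg) (signW u).
  under eq_fun do rewrite (truncation_sign2 m _ mY v0 Yv).
  by move=> /(cvg_lim _) <-//; rewrite lim_cst.
have Pfg u u' : fine (P (sign_event (S n) u `&` sign_event (fun x i => S n x i + W x i) u'))
    @[n --> \oo] --> fine (P (sign_event f u `&` sign_event g u')).
  apply: fine_cvg; rewrite fineK; last first.
    by apply: fin_num_measure; apply: measurableI; exact: measurable_sign_event.
  apply: cvg_probability_ae.
  - by move=> n; apply: measurableI; exact: measurable_sign_event.
  - by apply: measurableI; exact: measurable_sign_event.
  - apply: filterS2 (signS u) (signW u') => x; apply: filterS2 => n h h'.
    by split => -[/h ? /h' ?].
have main : 2 * (1 - expR (- (d%:R * (kappa ^+ (2 * m.+1) / 32)))) <=
    \sum_(u : {ffun 'I_d -> bool}) \sum_(u' : {ffun 'I_d -> bool})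
    `|fine (P (sign_event f u `&` sign_event g u')) - 4^-1 ^+ d|.
  have cv : \sum_(u : {ffun 'I_d -> bool}) \sum_(u' : {ffun 'I_d -> bool})
      `|fine (P (sign_event (S n) u `&` sign_event (fun x i => S n x i + W x i) u')) - 4^-1 ^+ d|
      @[n --> \oo] --> \sum_(u : {ffun 'I_d -> bool}) \sum_(u' : {ffun 'I_d -> bool})
      `|fine (P (sign_event f u `&` sign_event g u')) - 4^-1 ^+ d|.
    apply: (cvg_big add_continuous) => u _; apply: (cvg_big add_continuous) => u' _.
    by apply: cvg_norm; apply: cvgB; [exact: Pfg|exact: cvg_cst].
  apply: (cvgr_to_ge cv).
  (* Take [p = kappa ^+ m.+1]. Multiplying [w] by [p] turns its [m.+1] terms into the first [m.+1]
     terms of the sum defining [a], so [p * w <= a] once [n >= m]. *)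
  exists m => // n /= mn; rewrite mulnC exprM; apply: (truncation_affinity mY v0 Yv).
    by rewrite kn0 exprn_ile1// ltW.
  have vE (l : nat) : kappa ^+ m.+1 ^+ 2 * v l ^+ 2 = v (m.+1 + l)%N ^+ 2.
    by rewrite /v exprD -exprMn mulrA.
  rewrite -[X in X * _]gtr0_norm// -sqrtr_sqr -sqrtrM ?sqr_ge0//.
  rewrite ler_sqrt; last by apply: sumr_ge0 => l _; rewrite sqr_ge0.
  rewrite mulr_sumr; under eq_bigr do rewrite vE.
  rewrite -!(big_mkord xpredT (fun l => v (m.+1 + l)%N ^+ 2)).
  by rewrite (@big_cat_nat _ _ _ m.+1 0 n.+1)//= lerDl sumr_ge0// => l _; rewrite sqr_ge0.
(* Blocks of a partition must be nonempty; here each has the positive probability [2^-d]. *)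
have e0 (h : T -> 'I_d -> R) : (forall u, P (sign_event h u) = (2^-1 ^+ d)%:E) ->
    forall u, sign_event h u !=set0.
  move=> Ph u; apply/set0P/eqP => h0; have := Ph u; rewrite h0 measure0 => -[/eqP].
  by rewrite eq_sym expf_eq0 invr_eq0 pnatr_eq0 andbF.
(* The supremum over base times is bounded below by its value at [j = 0]. *)
apply: (@le_trans _ _ (beta_coef P
  (sigma_gen (fun t w => X t w) [set t | (t <= 0)%R])
  (sigma_gen (fun t w => X t w) [set t | (0 + m.+1%:Z <= t)%R]))); last first.
  by apply: ereal_sup_ubound; exists 0.
apply: le_trans (@beta_coef_ge _ _ _ P _ _ _ _ (sign_event f) (sign_event g) _ _ _ _).
- under eq_bigr => u _.
    under eq_bigr => u' _.
      rewrite Pf Pg -EFinM -exprMn (_ : 2^-1 * 2^-1 = 4^-1); last by field.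
      rewrite -(@fineK _ (P _)); last first.
        by apply: fin_num_measure; apply: measurableI; exact: measurable_sign_event.
      rewrite -EFinB abse_EFin; over.
    rewrite sumEFin; over.
  by rewrite sumEFin -EFinM lee_fin; move: main; lra.
- exact: sign_event_partition (e0 _ Pf).
- by move=> u; apply: sigma_gen_sign_event => /=.
- exact: sign_event_partition (e0 _ Pg).
- by move=> u; apply: sigma_gen_sign_event => /=; rewrite add0r.
Qed.

End autoregression.

(** * Explicit lower bound and its asymptotic consequences *)

Lemma limn_einf_ge {R : realType} (u : (\bar R)^nat) (a : \bar R) :
  (\forall n \near \oo, a <= u n)%E -> (a <= limn_einf u)%E.
Proof.
move=> [N _ aN]; rewrite limn_einf_lim (cvg_lim _ (@cvg_einfs_sup _ u))//.
apply: (@le_trans _ _ (einfs u N)); last by apply: ereal_sup_ubound; exists N.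
by apply: le_ereal_inf_tmp => _ [k /= Nk <-]; exact: aN.
Qed.

(** Writing [2] as [exp (ln 2)], the strict inequality [K * ln 2 < c] makes [1 - 2 * exp (- c / K)]
    a positive constant, which bounds [b n] from below eventually. *)
Lemma limn_einf_gt0 {R : realType} (b : (\bar R)^nat) (x : nat -> R) (K c : R) :
  0 < K -> K * ln 2 < c -> (\forall n \near \oo, c <= x n) ->
  (\forall n \near \oo, ((1 - 2 * expR (- (x n / K)))%:E <= b n)%E) ->
  (0 < limn_einf b)%E.
Proof.
move=> K0 Kc cx xb.
apply: (@lt_le_trans _ _ (1 - 2 * expR (- (c / K)))%:E).
  rewrite lte_fin subr_gt0 -(@lnK _ 2) ?posrE// -expRD expR_lt1 subr_lt0.
  by rewrite ltr_pdivlMr// mulrC.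
apply: limn_einf_ge; apply: filterS2 cx xb => n cxn; apply: le_trans.
rewrite lee_fin lerD2l lerN2 ler_pM2l// ler_expR lerN2 ler_pM2r//.
by rewrite invr_gt0.
Qed.

Theorem theorem3p2 (disp : measure_display) (T : measurableType disp)
    (R : realType) (P : probability T R)
    (d : nat -> nat) (kappa : nat -> R)
    (E X : forall n : nat, int -> {RV P >-> (d n).-tuple R})
    (d_gt0 : forall n, (0 < n)%N -> (0 < d n)%N)
    (kappa01 : forall n, (0 < n)%N -> 0 < kappa n < 1)
    (E_iid : forall n, (0 < n)%N -> iid P (fun t w => E n t w))
    (E_gauss : forall n, (0 < n)%N ->
       forall t : int, nondegenerate_gaussian P (E n t))
    (E_comp_iid : forall n, (0 < n)%N ->
       iid P (fun (i : 'I_(d n)) (w : T) => tnth (E n 0 w) i))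
    (X_def : forall n, (0 < n)%N -> forall t : int,
       {ae P, forall w, forall i : 'I_(d n),
         series (fun j : nat => kappa n ^+ j * tnth (E n (t - j%:Z) w) i) @ \oo
           --> tnth (X n t w) i}) :
  [/\ forall n m : nat, (0 < n)%N -> (0 < m)%N ->
        ((1 - 2 * expR (- ((d n)%:R * kappa n ^+ (2 * m) / (18 * pi ^+ 2))))%:E
          <= beta_mixing P (X n) m)%E,
      forall (d0 : nat) (l : R),
        (forall n, (0 < n)%N -> d n = d0) ->
        (kappa n ^+ (2 * n) @[n --> \oo] --> l) ->
        18 * pi ^+ 2 * ln 2 / d0%:R < l ->
        (0 < limn_einf (fun n => beta_mixing P (X n) n))%E &
      forall (kappa0 : R) (l : \bar R),
        (forall n, (0 < n)%N -> kappa n = kappa0) ->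
        (((d n)%:R * kappa0 ^+ (2 * n))%:E @[n --> \oo] --> l) ->
        ((18 * pi ^+ 2 * ln 2)%:E < l)%E ->
        (0 < limn_einf (fun n => beta_mixing P (X n) n))%E].
Proof.
pose K : R := 18 * pi ^+ 2.
have K0 : 0 < K by rewrite mulr_gt0// exprn_gt0// pi_gt0.
(* From [pi >= 2] one gets [K >= 72], enough to replace the constant 32 by [K]. *)
have K32 : 32 <= K.
  have p2 := @pi_ge2 R.
  by rewrite /K; nra.
have bound n m : (0 < n)%N -> (0 < m)%N ->
    ((1 - 2 * expR (- ((d n)%:R * kappa n ^+ (2 * m) / K)))%:E
      <= beta_mixing P (X n) m)%E.
  move=> n0 m0.
  have := beta_mixing_ge_affinity (d_gt0 n n0) (kappa01 n n0) (E_iid n n0)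
    (E_gauss n n0 0) (E_comp_iid n n0) (X_def n n0) m0.
  apply: le_trans; rewrite lee_fin lerD2l lerN2 mulrA.
  set x := (d n)%:R * _.
  have x0 : 0 <= x by rewrite mulr_ge0// exprn_ge0//; case/andP: (kappa01 n n0) => /ltW.
  apply: (@le_trans _ _ (expR (- (x / K)))).
    by rewrite ler_expR lerN2 ler_wpM2l// lef_pV2 ?posrE.
  by rewrite ler_peMl ?expR_ge0// ler1n.
have diag : \forall n \near \oo,
    ((1 - 2 * expR (- ((d n)%:R * kappa n ^+ (2 * n) / K)))%:E
      <= beta_mixing P (X n) n)%E.
  by exists 1%N => // n /= n0; exact: bound.
split=> //.
- move=> d0 l dE kl Kl.
  have d00 : 0 < d0%:R :> R by rewrite ltr0n -(dE 1%N)// d_gt0.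
  (* The midpoint of the threshold and the limit stays below [kappa n ^+ (2 * n)] for large [n]. *)
  pose c := (K * ln 2 / d0%:R + l) / 2.
  apply: (@limn_einf_gt0 _ _ (fun n => (d n)%:R * kappa n ^+ (2 * n)) K (d0%:R * c)) => //.
    by rewrite (mulrC d0%:R) -ltr_pdivrMr// /c -/K; move: Kl; rewrite -/K; lra.
  have cl : c < l by rewrite /c; move: Kl; rewrite -/K; lra.
  have [N _ Nc] := cvgr_ge _ kl _ cl.
  (* Starting at [N.+1] ensures [n > 0], as [dE] requires. *)
  exists N.+1 => // n /= Nn; rewrite dE ?(leq_ltn_trans _ Nn)// ler_pM2l//.
  exact: Nc (ltnW Nn).
- move=> kappa0 l kE xl Kl.
  (* The limit [l] may be infinite; then any real number above the threshold serves as [c]. *)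
  have [c Kc cl] : exists2 c : R, K * ln 2 < c & (c%:E < l)%E.
    move: l Kl {xl} => [l||//].
      rewrite lte_fin -/K => Kl; exists ((K * ln 2 + l) / 2); first by lra.
      by rewrite lte_fin; lra.
    by move=> _; exists (K * ln 2 + 1); [rewrite ltrDl|rewrite ltry].
  apply: (@limn_einf_gt0 _ _ (fun n => (d n)%:R * kappa n ^+ (2 * n)) K c) => //.
  have [N _ Nc] := xl _ (open_ereal_gt' cl); exists N.+1 => // n /= Nn.
  by rewrite kE ?(leq_ltn_trans _ Nn)// ltW// -lte_fin; exact: Nc (ltnW Nn).
Qed.
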